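(* Let $d\ge3$ and let $C$ be a $d$-dimensional Archimedean copula with generator $\psi$ and Williamson measure $\gamma$. Then: (1) if $\gamma$ is absolutely continuous then $\mu_C^{abs}(\mathbb{I}^d)=1$, i.e. $C$ is absolutely continuous; (2) if $\gamma$ is discrete then $\mu_C^{dis}(\mathbb{I}^d)=1$; (3) if $\gamma$ is singular (with respect to Lebesgue measure) without point masses then $\mu_C^{sing}(\mathbb{I}^d)=1$.
   Context: $\mathbb{I}=[0,1]$. An Archimedean generator is a continuous non-increasing $\psi:[0,\infty)\to\mathbb{I}$ with $\psi(0)=1$, $\lim_{z\to\infty}\psi(z)=0$, strictly decreasing on $[0,\inf\{z:\psi(z)=0\}]$, normalized by $\psi(1)=1/2$; pseudo-inverse $\varphi$. $C(\mathbf{u})=\psi(\sum_{i=1}^d\varphi(u_i))$ is a copula iff $(-1)^{d-2}\psi^{(d-2)}$ exists on $(0,\infty)$ and is non-negative, non-increasing and convex. The Williamson measure of $\psi$ is the unique probability measure $\gamma$ on $\mathcal{B}([0,\infty))$ with $\gamma(\{0\})=0$ and $\psi(z)=\int(1-tz)_+^{d-1}d\gamma(t)$ for $z>0$. $C^{1:d-1}(\mathbf{x})=C(\mathbf{x},1)$ is absolutely continuous with density $c^{1:d-1}$. Let $K_C$ be the $(d-1)$-Markov kernel of $C$ (regular conditional distribution of the last coordinate given the first $d-1$) and decompose $K_C(\mathbf{x},\cdot)=K_C^{dis}(\mathbf{x},\cdot)+K_C^{sing}(\mathbf{x},\cdot)+K_C^{abs}(\mathbf{x},\cdot)$ into sub-Markov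 kernels with $K_C^{dis}(\mathbf{x},\cdot)$ discrete, $K_C^{sing}(\mathbf{x},\cdot)$ singular without point masses and $K_C^{abs}(\mathbf{x},\cdot)$ absolutely continuous. For $\star\in\{dis,sing,abs\}$ define $\mu_C^\star(G)=\int_{\mathbb{I}^{d-1}}K_C^\star(\mathbf{x},G_\mathbf{x})c^{1:d-1}(\mathbf{x})\,d\lambda_{d-1}(\mathbf{x})$ for Borel $G\subseteq\mathbb{I}^d$, where $G_\mathbf{x}=\{y:(\mathbf{x},y)\in G\}$. *)

(* Defs.v *)
From HB Require Import structures.
From mathcomp Require Import all_boot all_order all_algebra.
From mathcomp Require Import all_classical all_reals all_analysis.
Set Implicit Arguments. Unset Strict Implicit. Unset Printing Implicit Defensive.
Import Order.TTheory GRing.Theory Num.Theory.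
Import numFieldNormedType.Exports.
Local Open Scope classical_set_scope.
Local Open Scope ring_scope.

Section defs.
Variable R : realType.
Local Open Scope ereal_scope.

(* Iterated Lebesgue integral over R^n (points are n-tuples) of a
   [0,+oo]-valued function: int_{R^(n+1)} f = int_R (int_{R^n} f(x::t) dt) dx.
   For nonnegative measurable f this is the integral w.r.t. lambda_n
   (Tonelli). *)
Fixpoint lebint (n : nat) : (n.-tuple R -> \bar R) -> \bar R :=
  match n with
  | 0 => fun f => f [tuple]
  | n'.+1 => fun f =>
      \int[@lebesgue_measure R]_x lebint (fun t => f (cons_tuple x t))
  end.

Definition cube (n : nat) : set (n.-tuple R) :=
  [set x | forall i, (0 <= tnth x i <= 1)%R].

(* inf{ z >= 0 : psi z = u } in [0, +oo] (inf of the empty set = +oo) *)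
Definition level_inf (psi : R -> R) (u : R) : \bar R :=
  ereal_inf [set z%:E | z in [set z : R | (0 <= z)%R /\ psi z = u]].

Definition gen_zero (psi : R -> R) : \bar R := level_inf psi 0.

Definition archimedean_generator (psi : R -> R) : Prop :=
  (forall z, (0 <= z)%R -> (0 <= psi z <= 1)%R) /\
  {within `[0%R, +oo[, continuous psi} /\
  (forall a b, (0 <= a)%R -> (a <= b)%R -> (psi b <= psi a)%R) /\
  psi 0%R = 1%R /\
  (psi z @[z --> +oo%R] --> 0%R) /\
  (forall a b, (0 <= a)%R -> (a < b)%R -> b%:E <= gen_zero psi ->
      (psi b < psi a)%R) /\
  psi 1%R = 2^-1%R.

Definition pseudo_inv (psi : R -> R) (u : R) : \bar R := level_inf psi u.

Definition psi_ext (psi : R -> R) (z : \bar R) : R :=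
  match z with EFin r => psi r | _ => 0%R end.

(* The Archimedean copula C(x, y) = psi(sum_i phi(x_i) + phi(y)),
   points of I^d written as (x, y) with x in I^(d-1), y in I. *)
Definition arch_copula (psi : R -> R) (n : nat) (x : n.-tuple R) (y : R) : R :=
  psi_ext psi (\sum_(i < n) pseudo_inv psi (tnth x i) + pseudo_inv psi y).

(* mu is the probability measure mu_C on I^(d-1) x I = I^d whose
   distribution function on I^d is C (this is what "C is a copula" means) *)
Definition copula_measure_of (psi : R -> R) (n : nat)
    (mu : set (n.-tuple R * R) -> \bar R) : Prop :=
  mu [set: n.-tuple R * R] = 1 /\
  mu (~` (@cube n `*` `[0%R, 1%R]%classic)) = 0 /\
  forall x y, @cube n x -> (0 <= y <= 1)%R ->
    mu ([set x' | forall i, (0 <= tnth x' i <= tnth x i)%R] `*` `[0%R, y]%classic)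
      = (arch_copula psi x y)%:E.

Definition williamson_measure (psi : R -> R) (d : nat)
    (gamma : {measure set R -> \bar R}) : Prop :=
  [/\ gamma [set: R] = 1,
      gamma `]-oo, 0%R]%classic = 0 &
      forall z, (0 < z)%R ->
        (psi z)%:E = \int[gamma]_t ((Num.max (1 - t * z) 0) ^+ d.-1)%:E].

Definition marginal_density (n : nat) (mu : set (n.-tuple R * R) -> \bar R)
    (c : n.-tuple R -> R) : Prop :=
  [/\ forall x, (0 <= c x)%R,
      measurable_fun [set: n.-tuple R] c &
      forall A, measurable A ->
        mu (A `*` [set: R]) = lebint (fun x => (\1_A x * c x)%:E)].

Definition markov_kernel_of (n : nat) (mu : {measure set (n.-tuple R * R) -> \bar R})
    (K : n.-tuple R -> {measure set R -> \bar R}) : Prop :=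
  forall A B, measurable A -> measurable B ->
    mu (A `*` B) = \int[mu]_(p in A `*` [set: R]) K p.1 B.

Definition discrete_measure (nu : set R -> \bar R) : Prop :=
  exists S : set R, countable S /\ nu (~` S) = 0.

Definition singular_no_atoms (nu : set R -> \bar R) : Prop :=
  (forall t, nu [set t] = 0) /\
  exists N : set R, [/\ measurable N, @lebesgue_measure R N = 0 & nu (~` N) = 0].

Definition abs_continuous (nu : {measure set R -> \bar R}) : Prop :=
  nu `<< @lebesgue_measure R.

Definition mu_star (n : nat) (Kstar : n.-tuple R -> {measure set R -> \bar R})
    (c : n.-tuple R -> R) (G : set (n.-tuple R * R)) : \bar R :=
  lebint (fun x => (\1_(@cube n) x)%:E * Kstar x (xsection G x) * (c x)%:E).

End defs.
Arguments cube {R} n.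

(* Main.v *)
(* Let n = d - 1. If 1/T is the radius of the l1-norm symmetric vector behind C,
   with T distributed as gamma, then (Z_1, ..., Z_n, T) has density
   n! t^n 1{z >= 0, t (z_1 + ... + z_n) <= 1} with respect to
   lambda^n (x) gamma. The image of this law under
   (z, t) |-> (psi(z_1), ..., psi(z_n), psi(1/t - sum z)) has distribution
   function C, by the volume of a simplex and the Williamson formula, so it is
   mu_C. Hence for almost every x = psi(z) the kernel K(x, .) is, up to
   normalization, the image of t^n 1{t s <= 1} gamma(dt), s = sum z, under
   t |-> psi(1/t - s). Convexity of psi makes this map locally Lipschitz with
   locally Lipschitz inverse on the support of gamma, so the kernel inherits
   from gamma absolute continuity, discreteness, or singularity without atoms;
   uniqueness of the decomposition then forces one part of K(x, .) to carry all
   the mass. *)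
Require Import Defs.
From HB Require Import structures.
From mathcomp Require Import all_boot all_order all_algebra.
From mathcomp Require Import all_classical all_reals all_analysis.
From mathcomp Require Import measurable_realfun ring lra.
Import Order.TTheory GRing.Theory Num.Theory.
Import numFieldNormedType.Exports.
Local Open Scope classical_set_scope.
Local Open Scope ring_scope.
Set Implicit Arguments. Unset Strict Implicit. Unset Printing Implicit Defensive.

(** * Densities, image measures and Lebesgue measure on tuples *)

(** The copula is never differentiated: a Markov kernel is determined only up to null sets of the
    marginal, so it suffices to write down one explicit law with the right distribution function and
    to disintegrate it over z. The parameter is t = 1/radius because the Williamson integrand and
    the weight are then piecewise polynomial in t. Two obstacles shape the rest. Passing from x back
    to z requires psi to be injective, which it is only up to its first zero; since the Williamson
    integral vanishes at that zero, gamma is confined to those t with 1/t at most the zero. Moreover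
    no Lipschitz constant is uniform: psi may be infinitely steep at 0 and arbitrarily flat near its
    zero, so null sets are treated on countably many pieces. The density c enters only through the
    marginal of mu, so each claim becomes: the points x at which one part of the kernel has mass 1
    on [0, 1] carry all of mu. *)

Section measure_packing.
Context (R : realType).

(* Carrying the measurability proof makes this a measure by itself, whereas the
   canonical instance on [pushforward] leaves measurability as a side goal. *)
Definition mpushforward d d' (T : measurableType d) (U : measurableType d')
  (m : {measure set T -> \bar R}) (f : T -> U) (mf : measurable_fun setT f)
  : {measure set U -> \bar R}.
Proof. exact: (@pushforward _ _ T U R m f). Defined.

Lemma mpushforwardE d d' (T : measurableType d) (U : measurableType d')
  (m : {measure set T -> \bar R}) (f : T -> U) (mf : measurable_fun setT f) A :
  mpushforward m mf A = m (f @^-1` A).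
Proof. by []. Qed.

Lemma ge0_integral_mpushforward d d' (T : measurableType d) (U : measurableType d')
  (m : {measure set T -> \bar R}) (f : T -> U) (mf : measurable_fun setT f)
  (g : U -> \bar R) : measurable_fun setT g -> (forall y, 0 <= g y)%E ->
  (\int[mpushforward m mf]_y g y = \int[m]_x g (f x))%E.
Proof. by move=> mg g0; rewrite [LHS](ge0_integral_pushforward mf). Qed.

(** Products and Tonelli expect the bundled structure, whereas sigma-finiteness of the measures
    below is established after their construction. *)
Lemma sigma_finite_measureW d (T : measurableType d)
    (m : {measure set T -> \bar R}) : sigma_finite setT m ->
  exists m' : {sigma_finite_measure set T -> \bar R},
    (m' : set T -> \bar R) = m.
Proof.
move=> msf.
pose mix0 := isSFinite.Build _ _ _ (Measure.sort m) (sfinite_measure_sigma_finite msf).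
pose mix := isSigmaFinite.Build _ _ _ (Measure.sort m) msf.
pose m' : {sigma_finite_measure set _ -> \bar R} :=
  HB.pack (Measure.sort m) mix0 mix.
by exists m'.
Qed.

End measure_packing.

Section density_measure.
Local Open Scope ereal_scope.
Context d (T : measurableType d) (R : realType).
Context (m : {measure set T -> \bar R}) (w : T -> R).

(** The proofs are arguments of the set function so that its measure structure can be inferred from
    the term itself. *)
Definition mdensity (mw : measurable_fun setT w) (w0 : forall x, (0 <= w x)%R)
    (A : set T) : \bar R := \int[m]_(x in A) (w x)%:E.

Context (mw : measurable_fun setT w) (w0 : forall x, (0 <= w x)%R).

Let mdensity0 : mdensity mw w0 set0 = 0.
Proof. exact: integral_set0. Qed.

Let mdensity_ge0 A : 0 <= mdensity mw w0 A.
Proof. by apply: integral_ge0 => x _; rewrite lee_fin. Qed.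

Let mdensity_sigma_additive : semi_sigma_additive (mdensity mw w0).
Proof.
move=> /= F mF tF mUF; rewrite /mdensity; apply: cvg_toP.
  apply: ereal_nondecreasing_is_cvgn => i j ij.
  by apply: lee_sum_nneg_natr => // k _ _; apply: integral_ge0 => x _; rewrite lee_fin.
rewrite ge0_integral_bigcup//.
- exact/measurable_EFinP/measurable_funTS.
- by move=> x _; rewrite lee_fin.
Qed.

HB.instance Definition _ := isMeasure.Build _ _ _ (mdensity mw w0)
  mdensity0 mdensity_ge0 mdensity_sigma_additive.

Import HBNNSimple.

Let integral_mdensity_nnsfun (f : {nnsfun T >-> R}) :
  \int[mdensity mw w0]_x (f x)%:E = \int[m]_x ((f x)%:E * (w x)%:E).
Proof.
under [LHS]eq_integral do rewrite fimfunE -fsumEFin//.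
rewrite [LHS]ge0_integral_fsum//; last 2 first.
  - by move=> r; exact/measurable_EFinP/measurableT_comp.
  - by move=> n x _; rewrite EFinM nnfun_muleindic_ge0.
under [RHS]eq_integral.
  move=> x xD; rewrite fimfunE -fsumEFin// ge0_mule_fsuml; last first.
    by move=> r; rewrite EFinM nnfun_muleindic_ge0.
  over.
rewrite [RHS]ge0_integral_fsum//; last 2 first.
  - move=> r; apply/measurable_EFinP/measurable_funM => //.
    exact/measurableT_comp.
  - move=> n x _; apply: mule_ge0; last by rewrite lee_fin.
    by rewrite EFinM nnfun_muleindic_ge0.
apply: eq_fsbigr => r; rewrite inE => -[x _ <-].
under eq_integral do rewrite EFinM.
rewrite integralZl_indic_nnsfun// integral_indic// setIT.
under [RHS]eq_integral do rewrite EFinM -muleA.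
rewrite [RHS]ge0_integralZl//; first last.
- by rewrite lee_fin.
- by move=> t _; rewrite mule_ge0// lee_fin.
- by apply/measurable_EFinP/measurable_funM.
congr (_ * _); rewrite [LHS]integral_mkcond; apply: eq_integral => t _.
by rewrite patchE indicE; case: ifPn; rewrite ?mul1e// mul0e.
Qed.

(** Additivity gives the case of simple functions; both sides pass to increasing limits by monotone
    convergence. *)
Lemma integral_mdensity (f : T -> \bar R) :
  measurable_fun setT f -> (forall x, 0 <= f x) ->
  \int[mdensity mw w0]_x f x = \int[m]_x (f x * (w x)%:E).
Proof.
move=> mf f0; pose f_ := nnsfun_approx measurableT mf.
have ff x : (f_ n x)%:E @[n --> \oo] --> f x by exact: cvg_nnsfun_approx.
transitivity (limn (fun n => \int[mdensity mw w0]_x (f_ n x)%:E)).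
  rewrite -monotone_convergence//=.
  - by apply: eq_integral => x _; apply/esym/cvg_lim => //; exact: ff.
  - by move=> n; exact/measurable_EFinP.
  - by move=> n x _; rewrite lee_fin.
  - by move=> x _ i j ij; rewrite lee_fin; exact/lefP/nd_nnsfun_approx.
under eq_fun do rewrite integral_mdensity_nnsfun.
rewrite -monotone_convergence//=; last 3 first.
- by move=> n; apply/measurable_EFinP/measurable_funM.
- by move=> n x _; rewrite mule_ge0// lee_fin.
- by move=> x _ i j ij; apply: lee_wpmul2r; rewrite lee_fin//; exact/lefP/nd_nnsfun_approx.
by apply: eq_integral => x _; apply/cvg_lim => //; exact: cvgeZr.
Qed.

End density_measure.

Section lebesgue_tuple.
Context (R : realType).
Local Open Scope ereal_scope.

Lemma measurable_cons_tuple n :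
  measurable_fun [set: measurableTypeR R * n.-tuple R]
    (fun p => cons_tuple (p.1 : R) p.2).
Proof.
apply: measurable_cons; last exact: measurable_snd.
by move=> mD Y mY; exact: (@measurable_fst _ _ _ (n.-tuple R)).
Qed.

(** The integral of a nonnegative function is a supremum over the simple functions below it, so
    monotonicity holds for arbitrary functions. This fits the integrand of [mu_star], which contains
    a section of a set. *)
Lemma le_lebint n (f g : n.-tuple R -> \bar R) :
  (forall x, 0 <= f x) -> (forall x, f x <= g x) -> lebint f <= lebint g.
Proof.
have lebint_ge0 k (h : k.-tuple R -> \bar R) :
    (forall x, 0 <= h x) -> 0 <= lebint h.
  elim: k h => [|k IH] h h0 //=.
  by apply: integral_ge0 => x _; exact: IH.
elim: n f g => [|n IH] f g f0 fg //=.
have f0' x : 0 <= lebint (fun t => f (cons_tuple x t)) by exact: lebint_ge0.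
have fg' x : lebint (fun t => f (cons_tuple x t)) <=
  lebint (fun t => g (cons_tuple x t)) by exact: IH.
rewrite !ge0_integralTE//; last by move=> x; exact: le_trans (fg' x).
apply: le_ereal_sup => _ [h /= hf <-]; exists h => //= x.
exact: le_trans (hf x) (fg' x).
Qed.

(* [lebesgue_measure] lives on [measurableTypeR R], whose display is not the one
   of [R] as a measurable type, although the measurable sets are the same. *)
Lemma cons_tuple_measure n (la : {sigma_finite_measure set (measurableTypeR R) -> \bar R})
    (rho : {sigma_finite_measure set (n.-tuple R) -> \bar R}) :
  exists rho' : {sigma_finite_measure set (n.+1.-tuple R) -> \bar R},
  forall f, measurable_fun setT f -> (forall x, 0 <= f x) ->
  \int[rho']_x f x = \int[la]_x \int[rho]_t f (cons_tuple x t).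
Proof.
pose cons (p : measurableTypeR R * n.-tuple R) := cons_tuple (p.1 : R) p.2.
have mcons : measurable_fun setT cons by exact: measurable_cons_tuple.
pose m := mpushforward (la \x rho) mcons.
have m_sf : sigma_finite setT m.
  have /sigma_finiteP[F [FT ndF Foo]] := sigma_finiteT la.
  have /sigma_finiteP[G [GT ndG Goo]] := sigma_finiteT rho.
  pose uncons (t : n.+1.-tuple R) := (thead t : measurableTypeR R, [tuple of behead t]).
  have consK : cancel cons uncons.
    by case=> x t; rewrite /uncons /cons /thead tnth0; congr (_, _); exact/val_inj.
  have munc : measurable_fun setT uncons.
    apply/measurable_fun_pair; [exact: measurable_tnth|exact: measurable_behead].
  (* Both exhaustions increase, so a point of [F i] x [G j] lies in the diagonal box of index
     [maxn i j]. *)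
  exists (fun i => uncons @^-1` (F i `*` G i)).
    rewrite -preimage_bigcup; apply/esym; rewrite -[RHS](preimage_setT uncons).
    congr (_ @^-1` _); apply/seteqP; split=> // -[x y] _.
    have [i _ Fix] : (\bigcup_k F k) x by rewrite -FT.
    have [j _ Gjy] : (\bigcup_k G k) y by rewrite -GT.
    exists (maxn i j) => //; split.
      by move: x Fix; exact/subsetPset/ndF/leq_maxl.
    by move: y Gjy; exact/subsetPset/ndG/leq_maxr.
  move=> i; have [mF Fi] := Foo i; have [mG Gi] := Goo i; split.
    by rewrite -[X in measurable X]setTI; apply: munc => //; exact: measurableX.
  rewrite mpushforwardE -comp_preimage (_ : uncons \o cons = id); last first.
    exact/funext/consK.
  change ((la \x rho) (F i `*` G i) < +oo).
  by rewrite product_measure1E// lte_mul_pinfty// ge0_fin_numE.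
have [rho' rho'E] := sigma_finite_measureW m_sf.
exists rho' => f mf f0.
rewrite (eq_measure_integral m) => [|A _ _]; last by rewrite -rho'E.
rewrite ge0_integral_mpushforward// fubini_tonelli1//=.
exact: measurableT_comp.
Qed.

(** Realizes the iterated integral by an actual measure, so that Tonelli and almost-everywhere
    arguments apply to it. *)
Lemma lebesgue_tuple_measure n :
  exists rho : {sigma_finite_measure set (n.-tuple R) -> \bar R},
  forall f, measurable_fun setT f -> (forall x, 0 <= f x) ->
  \int[rho]_x f x = lebint f.
Proof.
elim: n => [|n [rho rhoE]].
  exists (\d_([tuple] : 0.-tuple R)) => f mf f0.
  by rewrite integral_dirac// diracT mul1e.
have [rho' rho'E] := cons_tuple_measure (@lebesgue_measure R) rho.
exists rho' => f mf f0; rewrite rho'E//=; apply: eq_integral => x _; apply: rhoE => //.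
by apply: measurableT_comp => //; exact: measurable_cons.
Qed.

End lebesgue_tuple.

(** * Volume of a simplex *)

Section simplex_volume.
Context (R : realType).
Local Open Scope ereal_scope.

(** Dividing by the factorial makes the family stable under integration, which is what the induction
    on the dimension of the simplex needs. *)
Lemma integral_pow_fact n (a b : R) :
  \int[@lebesgue_measure R]_(x in `[a, b]) ((b - x) ^+ n / n`!%:R)%:E =
  (if (a <= b)%R then (b - a) ^+ n.+1 / n.+1`!%:R else 0)%:E.
Proof.
case: ltgtP => [ab|ba|->]; last 2 first.
- by rewrite set_itv_ge ?integral_set0// -leNgt.
- by rewrite set_itv1 integral_set1 subrr expr0n mul0r.
pose F : R -> R := (- (n.+1`!%:R)^-1 : R)%R *: ((cst b - id : R -> R) ^+ n.+1)%R.
have FE x : F x = (- ((b - x) ^+ n.+1 / n.+1`!%:R))%R.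
  rewrite /F [LHS]mulNr mulrC; congr (- (_ * _))%R.
  by elim: n.+1 => [|m IH]; [rewrite !expr0|rewrite !exprS -IH].
have dF (x : R) : is_derive x (1%R : R) F ((b - x) ^+ n / n`!%:R)%R.
  apply: is_derive_eq.
  change (- (n.+1`!%:R)^-1 * ((n.+1%:R * (b - x) ^+ n) * (0 - 1)) =
    (b - x) ^+ n / n`!%:R)%R.
  have f0 : (n`!%:R : R) != 0%R by rewrite pnatr_eq0 -lt0n fact_gt0.
  have n0 : (n.+1%:R : R) != 0%R by rewrite pnatr_eq0.
  by rewrite factS natrM; field; rewrite f0 nat1r n0.
rewrite (@continuous_FTC2 _ (fun x => (b - x) ^+ n / n`!%:R)%R F)//.
- by rewrite !FE subrr expr0n mul0r -EFinB opprK oppr0 add0r.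
- apply: continuous_subspaceT => x.
  apply: cvgM; last exact: cvg_cst.
  apply: (@continuous_comp _ _ _ (fun x : R => b - x)%R (fun y : R => y ^+ n)%R).
    by apply: cvgB; [exact: cvg_cst|exact: cvg_id].
  exact: exprn_continuous.
- have cF x : {for x, continuous F}.
    by apply/differentiable_continuous/derivable1_diffP.
  by split => //; [exact/cvg_at_right_filter/cF|exact/cvg_at_left_filter/cF].
- by move=> x _; rewrite derive1E; exact: derive_val.
Qed.

Lemma lebint0 n : lebint (fun _ : n.-tuple R => 0) = 0.
Proof. by elim: n => //= n ->; exact: integral0. Qed.

(** The simplex with corner [a] and edge length r - sum a. The corner is general because the event
    x'_i <= x_i reads z_i >= phi(x_i). *)
Definition above_below n (a : n.-tuple R) (r : R) : set (n.-tuple R) :=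
  [set z | (forall i, tnth a i <= tnth z i)%R /\ (\sum_i tnth z i <= r)%R].

(** Fixing the first coordinate x leaves a simplex of one dimension less with bound r - x, hence the
    induction with [r] free. *)
Lemma simplex_volume n (a : n.-tuple R) (r : R) :
  lebint (fun z => (\1_(above_below a r) z)%:E) =
  (if (\sum_i tnth a i <= r)%R
   then (r - \sum_i tnth a i) ^+ n / n`!%:R else 0)%:E.
Proof.
elim: n => [|n IH] in a r *.
  rewrite /= !big_ord0 subr0 indicE expr0 divr1.
  have -> : ([tuple] \in above_below a r) = (0 <= r)%R.
    apply/idP/idP => [/set_mem[_]|r0]; first by rewrite big_ord0.
    by apply/mem_set; split => [[]//|]; rewrite big_ord0.
  by case: ifP.
case/tupleP: a => a0 a /=.
have aE : (\sum_i tnth (cons_tuple a0 a) i = a0 + \sum_i tnth a i)%R.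
  by rewrite big_ord_recl tnth0; congr (_ + _)%R; apply: eq_bigr => i _; rewrite tnthS.
have cE x t : (\1_(above_below (cons_tuple a0 a) r) (cons_tuple x t) : R) =
    (if a0 <= x then \1_(above_below a (r - x)) t else 0)%R.
  rewrite !indicE.
  have -> : (cons_tuple x t \in above_below (cons_tuple a0 a) r) =
      (a0 <= x)%R && (t \in above_below a (r - x)).
    apply/idP/andP => [/set_mem[az sz]|[ax /set_mem[az sz]]].
    - split; first by have := az ord0; rewrite !tnth0.
      apply/mem_set; split => [i|]; first by have := az (lift ord0 i); rewrite !tnthS.
      move: sz; rewrite big_ord_recl tnth0 lerBrDl.
      by under eq_bigr do rewrite tnthS.
    - apply/mem_set; split => [i|].
        by case: (unliftP ord0 i) => [j|] ->; rewrite ?tnthS ?tnth0.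
      rewrite big_ord_recl tnth0 -lerBrDl.
      by under eq_bigr do rewrite tnthS.
  by case: ifP.
transitivity (\int[@lebesgue_measure R]_(x in `[a0, (r - \sum_i tnth a i)%R])
    ((r - \sum_i tnth a i - x) ^+ n / n`!%:R)%:E); last first.
  by rewrite integral_pow_fact aE -lerBrDr opprD addrA [(r - a0 - _)%R]addrAC.
rewrite [RHS]integral_mkcond; apply: eq_integral => x _.
rewrite patchE mem_setE in_itv/=.
under eq_fun do rewrite cE.
case: (leP a0 x) => [ax|xa]; last exact: lebint0.
rewrite IH lerBrDr addrC -lerBrDr; case: ifP => // _.
by rewrite addrAC.
Qed.

End simplex_volume.

(** * Archimedean generators *)

Section archimedean_generator.
Context (R : realType) (psi : R -> R) (hpsi : archimedean_generator psi).

(* Extending the generator by its value at 0 makes it continuous on R. *)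
Definition genext (z : R) : R := psi (Num.max z 0).

Lemma genextE z : 0 <= z -> genext z = psi z.
Proof. by move=> z0; rewrite /genext max_l. Qed.

Lemma genext0 : genext 0 = 1.
Proof. by rewrite genextE//; case: hpsi => _ [_ [_ []]]. Qed.

Lemma genext_itv z : 0 <= genext z <= 1.
Proof. by case: hpsi => + _; apply; rewrite le_max lexx orbT. Qed.

Lemma genext_nincr : nonincreasing_fun genext.
Proof.
move=> a b ab; case: hpsi => _ [_ [+ _]]; apply.
  by rewrite le_max lexx orbT.
by rewrite ge_max !le_max ab lexx orbT.
Qed.

Lemma genext_continuous : continuous genext.
Proof.
move=> x; case: hpsi => _ [/subspace_continuousP psic _].
have mc : {for x, continuous (fun y : R => Num.max y 0)}.
  apply: (@continuous_max _ _ idfun (cst 0)); [exact: cvg_id|exact: cvg_cst].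
apply: (@cvg_comp _ _ _ (fun y : R => Num.max y 0) psi _
  (within `[0, +oo[ (nbhs (Num.max x 0)))).
  move=> U AU.
  have : nbhs x [set y | `[0, +oo[%classic (Num.max y 0) -> U (Num.max y 0)].
    exact: (mc [set y | `[0, +oo[%classic y -> U y] AU).
  apply: filterS => y; apply.
  by rewrite /= in_itv/= andbT le_max lexx orbT.
by apply: psic; rewrite /= in_itv/= andbT le_max lexx orbT.
Qed.

Lemma measurable_genext : measurable_fun setT genext.
Proof. by apply: continuous_measurable_fun; exact: genext_continuous. Qed.

Lemma level_inf_ge0 u : (0 <= level_inf psi u)%E.
Proof. by apply: le_ereal_inf_tmp => _ [z [z0 _] <-]; rewrite lee_fin. Qed.

(** A Galois connection between psi and its pseudo-inverse, valid even if the latter is infinite. If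
    psi z <= u, the intermediate value theorem finds the level u in [0, z]; if psi z > u, continuity
    and monotonicity keep psi above u up to some point beyond z. *)
Lemma level_infP u z : 0 <= u <= 1 -> 0 <= z ->
  (level_inf psi u <= z%:E)%E = (psi z <= u).
Proof.
move=> /andP[u0 u1] z0; apply/idP/idP => [uz|zu]; last first.
  have [|c] := @IVT _ genext 0 z u z0 (continuous_subspaceT genext_continuous).
    by rewrite genext0 genextE// ge_min zu orbT le_max u1.
  rewrite in_itv/= => /andP[c0 cz]; rewrite genextE// => cu.
  apply: (@le_trans _ _ c%:E); last by rewrite lee_fin.
  by apply: ereal_inf_lbound; exists c.
rewrite leNgt; apply/negP => uz'.
have : \forall y \near z, u < genext y.
  have /cvgr_gt : genext y @[y --> z] --> genext z by exact: genext_continuous.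
  by apply; rewrite genextE.
move=> /nbhs_ballP[e/= e0 eb].
have : ((z + e)%:E <= level_inf psi u)%E.
  apply: le_ereal_inf_tmp => _ [c [c0 cu] <-]; rewrite lee_fin leNgt.
  apply/negP => cze.
  suff : u < genext c by rewrite genextE// cu ltxx.
  have [cz|zc] := leP c z.
    by apply: (lt_le_trans uz'); rewrite -genextE//; exact: genext_nincr.
  by apply: eb; rewrite /ball/= ltr0_norm ?subr_lt0// opprB ltrBlDl.
move=> /le_trans/(_ uz); rewrite lee_fin leNgt => /negP; apply.
by rewrite ltrDl.
Qed.

Lemma level_inf_gen z : 0 <= z -> (z%:E <= gen_zero psi)%E ->
  level_inf psi (psi z) = z%:E.
Proof.
move=> z0 zg; apply/eqP; rewrite eq_le level_infP ?lexx//=; last first.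
  by case: hpsi => + _; apply.
apply: le_ereal_inf_tmp => _ [c [c0 cz] <-]; rewrite lee_fin leNgt.
apply/negP => cltz; case: hpsi => _ [_ [_ [_ [_ [+ _]]]]].
by move=> /(_ c z c0 cltz zg); rewrite cz ltxx.
Qed.

Lemma level_inf_fin u : 0 <= u <= 1 -> level_inf psi u \is a fin_num ->
  psi (fine (level_inf psi u)) = u.
Proof.
move=> u01 ufin.
have u'0 : 0 <= fine (level_inf psi u) by rewrite fine_ge0 ?level_inf_ge0.
apply/eqP; rewrite eq_le -level_infP// fineK// lexx/= leNgt.
apply/negP => ltu; have /andP[u0 u1] := u01.
have [|c] := @IVT _ genext 0 (fine (level_inf psi u)) u u'0
    (continuous_subspaceT genext_continuous).
  by rewrite genext0 genextE// ge_min (ltW ltu) orbT le_max u1.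
rewrite in_itv/= => /andP[c0 cz]; rewrite genextE// => cu.
have : (level_inf psi u <= c%:E)%E by apply: ereal_inf_lbound; exists c.
rewrite -[in X in (X <= _)%E](fineK ufin) lee_fin => zc.
have cE : c = fine (level_inf psi u) by apply/eqP; rewrite eq_le cz zc.
by move: ltu; rewrite -cE cu ltxx.
Qed.

(* Arguments are clamped to [0, 1]; the junk value [fine +oo = 0] only occurs at
   0 for generators without zero, a value they do not take. *)
Definition gen_inv (u : R) : R :=
  fine (level_inf psi (Num.min (Num.max u 0) 1)).

(** By [level_infP], the pseudo-inverse exceeds r >= 0 exactly when the clamped argument lies below
    psi r, so preimages of rays come from rays. *)
Lemma measurable_gen_inv : measurable_fun setT gen_inv.
Proof.
pose clamp (u : R) := Num.min (Num.max u 0) 1.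
have mclamp : measurable_fun setT clamp.
  by apply: measurable_minr => //; exact: measurable_maxr.
have clamp01 u : 0 <= clamp u <= 1.
  by rewrite /clamp le_min ge_min !le_max !lexx ler01 !orbT.
apply: (measurableT_comp (f := fine) (g := fun u => level_inf psi (clamp u))).
  exact: fine_measurable.
move=> mD; apply: (measurability _ (ErealGenOInfty.measurableE R)) => //.
move=> _ [_ [r ->] <-]; rewrite setTI.
have [r0|r0] := ltP r 0.
  rewrite (_ : _ @^-1` _ = setT)//; apply/seteqP; split=> // u _ /=.
  rewrite in_itv/= andbT; apply: lt_le_trans (level_inf_ge0 _).
  by rewrite lte_fin.
rewrite (_ : _ @^-1` _ = clamp @^-1` `]-oo, (psi r)[%classic).
  by rewrite -[X in measurable X]setTI; exact: mclamp.
apply/seteqP; split => u /=; rewrite !in_itv/= andbT !ltNge level_infP//.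
Qed.

Lemma gen_invK z : 0 <= z -> (z%:E <= gen_zero psi)%E -> gen_inv (psi z) = z.
Proof.
move=> z0 zg; rewrite /gen_inv.
have /andP[p0 p1] : 0 <= psi z <= 1 by case: hpsi => + _; apply.
by rewrite max_l// min_l// level_inf_gen.
Qed.

End archimedean_generator.

(** * Null sets under Lipschitz relations *)

Section null_sets.
Context (R : realType).
Local Open Scope ereal_scope.
Let la := @lebesgue_measure R.
Let l := @wlength R idfun.

(* Applied to the graph of a Lipschitz map and to the inverse graph of an
   expanding one. *)
Lemma negligible_lipschitz_rel (L : R) (rel : set (R * R)) (N : set R) :
  (0 <= L)%R ->
  (forall a b a' b', rel (a, a') -> rel (b, b') ->
    (`|a - b| <= L * `|a' - b'|)%R) ->
  la.-negligible N -> la.-negligible [set a | exists2 a', N a' & rel (a, a')].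
Proof.
move=> L0 Lip /negligible_outer_measure N0; apply/negligible_outer_measure.
apply/eqP; rewrite eq_le outer_measure_ge0 andbT.
apply/lee_addgt0Pr => e e0; rewrite add0e.
(* The points related to an interval of length w lie within L w of any one of them, hence in an
   interval of length 2 L w; the added 1 makes [c] positive, so that e / c makes sense when L =
   0. *)
pose c := (2 * L + 1)%R; have c0 : (0 < c)%R by rewrite ltr_wpDl// mulr_ge0.
have [F [Fitv FN] Fe] : exists2 I_, open_itv_cover N I_ &
    \sum_(0 <= k <oo) l (I_ k) <= (e / c)%:E.
  have : (l^* N)%mu\is a fin_num by rewrite N0.
  rewrite outer_measure_open_itv_cover.
  have ec0 : (0 < e / c)%R by rewrite divr_gt0.
  move=> /lb_ereal_inf_adherent-/(_ _ ec0)[_/= [F]] AF <- /ltW.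
  by rewrite -outer_measure_open_itv_cover N0 add0e => Fe; exists F.
pose S k := [set a | exists2 a', F k a' & rel (a, a')].
apply: (@le_trans _ _ (\sum_(0 <= k <oo) (l^* (S k))%mu)).
  apply: le_trans (outer_measure_sigma_subadditive la S).
  apply: (le_outer_measure la) => a [a' Na' ra].
  by have [k _ Fk] := FN _ Na'; exists k => //; exists a'.
apply: (@le_trans _ _ (\sum_(0 <= k <oo) (c%:E * l (F k)))); last first.
  rewrite nneseriesZl//.
  apply: (@le_trans _ _ (c%:E * (e / c)%:E)).
    by rewrite lee_wpmul2l// lee_fin ltW.
  by rewrite -EFinM lee_fin mulrC divfK// gt_eqF.
apply: lee_nneseries => [k _ _|k _]; first exact: outer_measure_ge0.
have [[x y] Fk] := Fitv k.
have [->|/set0P[a0 [a0' Fa0 r0]]] := eqVneq (S k) set0.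
  by rewrite outer_measure0 mule_ge0// ?lee_fin ?(ltW c0)// Fk; exact: wlength_ge0.
move: Fa0; rewrite Fk /= in_itv/= => /andP[xa0 a0y].
have xy := lt_trans xa0 a0y.
apply: (@le_trans _ _ (la `[(a0 - L * (y - x))%R, (a0 + L * (y - x))%R])).
  apply: le_outer_measure => a [a' + ra]; rewrite Fk/= !in_itv/= => /andP[xa ay].
  rewrite -ler_distl; apply: (le_trans (Lip _ _ _ _ ra r0)).
  by rewrite ler_wpM2l// ler_norml; lra.
rewrite /la lebesgue_measure_itv/= /l wlength_itv/= !lte_fin xy.
have Lxy : (0 <= L * (y - x))%R by rewrite mulr_ge0// subr_ge0 ltW.
case: ifP => _; rewrite -?EFinD -EFinM lee_fin /c.
  by rewrite /= mulrDl mul1r; lra.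
by rewrite mulr_ge0 ?ltW// subr_gt0.
Qed.

End null_sets.

(** * Consequences of the Williamson representation *)

Section williamson.
Context (R : realType) (psi : R -> R) (hpsi : archimedean_generator psi).
Context (n : nat) (n0 : (0 < n)%N) (gamma : {measure set R -> \bar R}).
Context (hgamma : williamson_measure psi n.+1 gamma).

Let W (z t : R) : R := Num.max (1 - t * z) 0 ^+ n.

Let W0 z t : 0 <= W z t.
Proof. by rewrite exprn_ge0// le_max lexx orbT. Qed.

Let mW z : measurable_fun setT (W z).
Proof.
apply: measurable_funX; apply: measurable_maxr => //.
by apply: measurable_funB => //; exact: measurable_funM.
Qed.

Lemma williamson_integral z : 0 <= z ->
  (psi z)%:E = (\int[gamma]_t (Num.max (1 - t * z) 0 ^+ n)%:E)%E.
Proof.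
have [gT g0 gW] := hgamma.
rewrite le_eqVlt => /predU1P[<-|/gW//].
have -> : psi 0 = 1 by case: hpsi => _ [_ [_ []]].
under eq_integral do rewrite mulr0 subr0 max_l ?ler01// expr1n.
by rewrite integral_cst// mul1e gT.
Qed.

(** In the induction step the defect is p q (x - y) (x^(m+1) - y^(m+1)), and the two differences
    have the same sign. *)
Let le_convex_pow (p q x y : R) m : 0 <= p -> 0 <= q -> 0 <= x -> 0 <= y ->
  p + q = 1 -> (p * x + q * y) ^+ m.+1 <= p * x ^+ m.+1 + q * y ^+ m.+1.
Proof.
move=> p0 q0 x0 y0 pq; elim: m => [|m IH]; first by rewrite !expr1.
rewrite exprS (le_trans (ler_wpM2l _ IH)) ?addr_ge0 ?mulr_ge0//.
have xy : 0 <= (x - y) * (x ^+ m.+1 - y ^+ m.+1).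
  have [xy|yx] := leP x y.
    rewrite mulr_le0 ?subr_le0//; by rewrite lerXn2r.
  by rewrite mulr_ge0 ?subr_ge0 ?(ltW yx)// lerXn2r// ltW.
have pq0 : 0 <= p * q by rewrite mulr_ge0.
have qE : q = 1 - p by rewrite -pq; ring.
rewrite -subr_ge0.
have <- : p * q * ((x - y) * (x ^+ m.+1 - y ^+ m.+1)) =
    p * x ^+ m.+2 + q * y ^+ m.+2 -
    (p * x + q * y) * (p * x ^+ m.+1 + q * y ^+ m.+1).
  by rewrite qE [x ^+ m.+2]exprS [y ^+ m.+2]exprS; ring.
exact: mulr_ge0.
Qed.

(** For each t the Williamson integrand is a power of the positive part of an affine function of z,
    hence convex in z, and integration preserves this. The division-free form includes a = c. *)
Lemma generator_convex a b c : 0 <= a -> a <= b -> b <= c ->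
  (c - a) * psi b <= (c - b) * psi a + (b - a) * psi c.
Proof.
move=> a0 ab bc.
have [ac|ac] := eqVneq a c.
  have -> : b = a by apply/eqP; rewrite eq_le ab ac bc.
  by rewrite ac subrr !mul0r addr0.
have ltac : 0 < c - a by rewrite subr_gt0 lt_neqAle ac (le_trans ab).
have b0 := le_trans a0 ab; have c0 := le_trans b0 bc.
have Wc t : (c - a) * W b t <= (c - b) * W a t + (b - a) * W c t.
  rewrite -(ler_pM2l (x := (c - a)^-1)) ?invr_gt0// mulrA mulVf ?gt_eqF//.
  rewrite mul1r mulrDr !mulrA.
  set p := (c - a)^-1 * (c - b); set q := (c - a)^-1 * (b - a).
  have p0 : 0 <= p by rewrite mulr_ge0 ?subr_ge0// invr_ge0 ltW.
  have q0 : 0 <= q by rewrite mulr_ge0 ?subr_ge0// invr_ge0 ltW.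
  have pq : p + q = 1.
    by rewrite /p /q -mulrDr addrA subrK mulVf ?gt_eqF.
  have bE : b = p * a + q * c.
    by rewrite /p /q; field; rewrite gt_eqF.
  clearbody p q; rewrite /W -(prednK n0).
  apply: le_trans (le_convex_pow _ _ _ _ _ pq) => //; rewrite ?le_max ?lexx ?orbT//.
  have M (x : R) : 0 <= Num.max x 0 /\ x <= Num.max x 0.
    by rewrite !le_max !lexx orbT.
  have [Ma1 Ma2] := M (1 - t * a); have [Mc1 Mc2] := M (1 - t * c).
  rewrite lerXn2r ?nnegrE ?addr_ge0 ?mulr_ge0 ?le_max ?lexx ?orbT//.
  rewrite ge_max addr_ge0 ?mulr_ge0// andbT [X in _ - t * X]bE.
  apply: (@le_trans _ _ (p * (1 - t * a) + q * (1 - t * c))).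
    by rewrite -[X in X - _]pq le_eqVlt; apply/orP; left; apply/eqP; ring.
  by rewrite lerD// ler_wpM2l.
rewrite -lee_fin EFinD !EFinM !williamson_integral//.
rewrite -!ge0_integralZl_EFin//; first last.
all: try (by move=> t _; rewrite lee_fin; exact: W0).
all: try (by apply/measurable_EFinP; exact: mW).
all: try (by rewrite subr_ge0// (le_trans ab)).
rewrite -ge0_integralD//; first last.
all: try (by move=> t _; rewrite mule_ge0// lee_fin ?subr_ge0//; exact: W0).
all: try (by apply: measurable_funeM; apply/measurable_EFinP; exact: mW).
apply: ge0_le_integral => //.
- by move=> t _; rewrite mule_ge0// lee_fin ?(ltW ltac)//; exact: W0.
- by apply: measurable_funeM; apply/measurable_EFinP; exact: mW.
- by apply: emeasurable_funD; apply: measurable_funeM; apply/measurable_EFinP; exact: mW.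
- by move=> t _; rewrite -!EFinM -EFinD lee_fin; exact: Wc.
Qed.

(** By convexity psi descends beyond z no faster than along the chord over [0, z], whose slope is at
    most 1/z because psi takes values in [0, 1]. *)
Lemma generator_lipschitz z z' : 0 < z -> z <= z' ->
  z * (psi z - psi z') <= z' - z.
Proof.
move=> z0 zz'; have := generator_convex (lexx 0) (ltW z0) zz'.
have -> : psi 0 = 1 by case: hpsi => _ [_ [_ []]].
have /andP[p0 _] : 0 <= psi z <= 1 by case: hpsi => + _; apply; exact: ltW.
by nra.
Qed.

(** By convexity the descent on [z, z'] is at least as steep as on [z', z' + s]; a drop of [dlt] > 0
    there makes the inverse of psi Lipschitz with constant s / dlt. *)
Lemma generator_expanding z z' s dlt : 0 <= z -> z <= z' -> 0 < s ->
  dlt <= psi z' - psi (z' + s) -> (z' - z) * dlt <= s * (psi z - psi z').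
Proof.
move=> z0 zz' s0 d.
have := @generator_convex z z' (z' + s) z0 zz'; rewrite lerDl => /(_ (ltW s0)).
by nra.
Qed.

Lemma gen_zero_gt0 : (0 < gen_zero psi)%E.
Proof.
rewrite ltNge level_infP//; last by rewrite lexx ler01.
have -> : psi 0 = 1 by case: hpsi => _ [_ [_ []]].
by rewrite -ltNge ltr01.
Qed.

(** At a finite first zero z0 the integral of the nonnegative (1 - t z0)_+^n vanishes, so 1 <= t z0
    for almost all t. Thus 1/t stays where psi is strictly decreasing. *)
Lemma williamson_support :
  gamma.-negligible (~` [set t | 0 < t /\ (t^-1%:E <= gen_zero psi)%E]).
Proof.
have [gT g0 gW] := hgamma.
have npos : gamma.-negligible `]-oo, 0]%classic by exists `]-oo, 0]%classic; split.
have [gfin|] := boolP (gen_zero psi \is a fin_num); last first.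
  rewrite ge0_fin_numE ?level_inf_ge0// -leNgt leye_eq => /eqP ->.
  apply: negligibleS npos => t /= ht; rewrite in_itv/= leNgt; apply/negP => t0.
  by apply: ht; split => //; rewrite leey.
set z0 := fine (gen_zero psi).
have zE : gen_zero psi = z0%:E by rewrite fineK.
have z0_gt0 : 0 < z0 by rewrite -lte_fin -zE gen_zero_gt0.
have psi0 : psi z0 = 0 by rewrite /z0 level_inf_fin// lexx ler01.
have : (\int[gamma]_t `|(W z0 t)%:E| = 0)%E.
  rewrite -[RHS](_ : (psi z0)%:E = 0%E); last by rewrite psi0.
  rewrite williamson_integral ?ltW//; apply: eq_integral => t _.
  by rewrite gee0_abs// lee_fin.
have mEW : measurable_fun setT (EFin \o W z0) by exact/measurable_EFinP.
move/(ae_eq_integral_abs gamma measurableT mEW) => W_ae.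
apply: negligibleS (negligibleU npos W_ae) => t /= ht.
have [t0|t0] := leP t 0; first by left; rewrite in_itv/=.
right=> /(_ I) [] /eqP; rewrite expf_eq0 n0/= => /eqP Wt.
apply: ht; split => //; rewrite zE lee_fin -(ler_pM2l t0) divff ?gt_eqF//.
have : 1 - t * z0 <= Num.max (1 - t * z0) 0 by rewrite le_max lexx.
by rewrite Wt subr_le0.
Qed.

End williamson.

(** * The kernel as a function of the radial part *)

Section radial_kernel.
Context (R : realType) (psi : R -> R) (hpsi : archimedean_generator psi).
Context (n : nat) (n0 : (0 < n)%N) (gamma : {measure set R -> \bar R}).
Context (hgamma : williamson_measure psi n.+1 gamma).

Lemma measurable_inv : measurable_fun setT (fun t : R => t^-1).
Proof.
rewrite -(setvU [set 0 : R]); apply/measurable_funU => //.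
  exact: measurableC.
split; last by apply: measurable_fun_set1.
apply: open_continuous_measurable_fun; first
  exact/closed_openC/accessible_closed_set1/hausdorff_accessible.
by move=> x /set_mem/eqP x0; exact: inv_continuous.
Qed.

(* Density of the law of (sum of the first coordinates, 1/radius) up to a
   factor depending on the first argument only: given radius 1/t, the first n
   coordinates of the simplex-uniform vector scaled by 1/t have constant
   density n! t^n on {z >= 0, t * sum z <= 1}. *)
Definition radial_weight (s t : R) : R :=
  if (0 < t) && (t * s <= 1) then n`!%:R * t ^+ n else 0.

Lemma radial_weight_ge0 s t : 0 <= radial_weight s t.
Proof.
by rewrite /radial_weight; case: ifP => // /andP[/ltW t0 _]; rewrite mulr_ge0 ?exprn_ge0.
Qed.

Lemma measurable_radial_weight d (T : measurableType d) (f g : T -> R) :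
  measurable_fun setT f -> measurable_fun setT g ->
  measurable_fun setT (fun x => radial_weight (f x) (g x)).
Proof.
move=> mf mg; apply: measurable_fun_ifT => //.
  apply: measurable_and; first exact: measurable_fun_ltr.
  by apply: measurable_fun_ler => //; exact: measurable_funM.
by apply: measurable_funM => //; exact: measurable_funX.
Qed.

(** For t > 0 with t s > 1 the extension returns the value 1 at a negative argument; the weight
    vanishes there. *)
Definition last_coord (s t : R) : R := genext psi (t^-1 - s).

Lemma measurable_last_coord d (T : measurableType d) (f g : T -> R) :
  measurable_fun setT f -> measurable_fun setT g ->
  measurable_fun setT (fun x => last_coord (f x) (g x)).
Proof.
move=> mf mg; apply: (measurableT_comp (measurable_genext hpsi)).
apply: measurable_funB => //.
exact: (measurableT_comp measurable_inv).
Qed.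

Lemma last_coord_itv s t : 0 <= last_coord s t <= 1.
Proof. exact: genext_itv. Qed.

Let mw s : measurable_fun setT (radial_weight s).
Proof. exact: measurable_radial_weight. Qed.

Let mT s : measurable_fun setT (last_coord s).
Proof. exact: measurable_last_coord. Qed.

Definition radial_kernel (s : R) : {measure set R -> \bar R} :=
  mpushforward (mdensity gamma (mw s) (radial_weight_ge0 s)) (mT s).

Lemma radial_kernelE s B : radial_kernel s B =
  (\int[gamma]_(t in last_coord s @^-1` B) (radial_weight s t)%:E)%E.
Proof. by []. Qed.

Let mTB s B : measurable B -> measurable (last_coord s @^-1` B).
Proof. by move=> mB; rewrite -[X in measurable X]setTI; exact: mT. Qed.

Lemma radial_kernel_null s B : measurable B ->
  gamma.-negligible [set t | [/\ 0 < t, t * s <= 1 & B (last_coord s t)]] ->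
  radial_kernel s B = 0.
Proof.
move=> mB neg; rewrite radial_kernelE.
transitivity (\int[gamma]_(t in last_coord s @^-1` B) `|(radial_weight s t)%:E|)%E.
  by apply: eq_integral => t _; rewrite gee0_abs// lee_fin radial_weight_ge0.
have mE : measurable_fun (last_coord s @^-1` B) (EFin \o radial_weight s).
  by apply/measurable_EFinP; exact: measurable_funTS.
apply: (ae_eq_integral_abs gamma (mTB s mB) mE).2.
apply: negligibleS neg => t /= /not_implyP[Bt]; rewrite /radial_weight.
by case: ifP => // /andP[].
Qed.

Lemma radial_kernel_fin s : 0 < s -> (radial_kernel s setT < +oo)%E.
Proof.
move=> s0; have [gT _ _] := hgamma.
rewrite radial_kernelE preimage_setT.
apply: (@le_lt_trans _ _ (\int[gamma]_(t in setT) (n`!%:R * (s^-1) ^+ n)%:E)%E).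
  apply: ge0_le_integral => //.
  - by move=> t _; rewrite lee_fin radial_weight_ge0.
  - exact/measurable_EFinP.
  move=> t _; rewrite lee_fin /radial_weight; case: ifP => [/andP[t0 ts]|_].
    rewrite ler_wpM2l// lerXn2r ?nnegrE ?invr_ge0 ?(ltW t0) ?(ltW s0)//.
    by rewrite -(ler_pM2r s0) mulVf ?gt_eqF.
  by rewrite mulr_ge0 ?exprn_ge0 ?invr_ge0 ?(ltW s0).
by rewrite integral_cst// gT mule1 ltry.
Qed.

Let good (s t : R) := [/\ 0 < t, t * s <= 1 & (t^-1%:E <= gen_zero psi)%E].

Let good_sub (s t : R) : 0 < t -> t * s <= 1 -> 0 <= t^-1 - s.
Proof.
by move=> t0 ts; rewrite subr_ge0 -(ler_pM2l t0) divff ?gt_eqF.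
Qed.

Let psi_decr (a b : R) : 0 <= a -> a < b -> (b%:E <= gen_zero psi)%E -> psi b < psi a.
Proof. by case: hpsi => _ [_ [_ [_ [_ [+ _]]]]]; apply. Qed.

(** As s >= 0, the arguments 1/t - s stay below the first zero, where psi is strictly decreasing. *)
Lemma last_coord_inj s t t' : 0 <= s -> good s t -> good s t' ->
  last_coord s t = last_coord s t' -> t = t'.
Proof.
move=> s0; wlog : t t' / t <= t'.
  move=> H gt gt'; have [/H|/ltW /H] := leP t t'; first exact.
  by move=> h /esym e; rewrite h.
rewrite le_eqVlt => /predU1P[//|tt'] [t0 ts tg] [t'0 t's t'g].
rewrite /last_coord !genextE ?good_sub// => e.
have vv : t'^-1 < t^-1 by rewrite ltf_pV2.
have : psi (t^-1 - s) < psi (t'^-1 - s).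
  apply: psi_decr; rewrite ?good_sub ?ltrD2r//.
  by apply: le_trans tg; rewrite lee_fin gerBl.
by rewrite e ltxx.
Qed.

Lemma radial_kernel_discrete s : discrete_measure gamma ->
  discrete_measure (radial_kernel s).
Proof.
move=> [S [cS S0]]; exists (last_coord s @` S); split.
  exact: card_le_trans (card_image_le _ _) cS.
apply: radial_kernel_null.
  apply/measurableC/countable_measurable => //.
  exact: card_le_trans (card_image_le _ _) cS.
exists (~` S); split => //; first exact/measurableC/countable_measurable.
by move=> t /= [_ _ h] St; apply: h; exists t.
Qed.

(** For gamma-almost all admissible t the drop of psi from 1/t - s to 1/t is positive, hence at
    least 1/(k+1) for some k. On each such piece the inverse map is Lipschitz, so it pulls
    Lebesgue-null sets back to Lebesgue-null, thus gamma-null, sets. *)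
Lemma radial_kernel_ac s : 0 < s -> abs_continuous gamma ->
  forall N, measurable N -> @lebesgue_measure R N = 0 -> radial_kernel s N = 0.
Proof.
move=> s0 /null_content_dominatesP gac N mN N0; apply: radial_kernel_null => //.
pose rel k := [set p : R * R | [/\ 0 < p.1, p.1 * s <= 1,
  p.2 = last_coord s p.1 & k.+1%:R^-1 <= psi (p.1^-1 - s) - psi (p.1^-1)]].
have negk k : gamma.-negligible [set t | exists2 y, N y & rel k (t, y)].
  have : (@lebesgue_measure R).-negligible [set t | exists2 y, N y & rel k (t, y)].
    (* [generator_expanding] bounds |1/t - 1/t'| by (k+1) s times the difference of the values;
       since t, t' <= 1/s, returning from 1/t to t costs a factor 1/s^2. *)
    apply: (@negligible_lipschitz_rel _ (k.+1%:R / s)); last by exists N; split.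
      by rewrite divr_ge0// ltW.
    move=> t t' y y'; wlog : t t' y y' / t <= t'.
      move=> H h h'; have [tt'|/ltW tt'] := leP t t'; first exact: H.
      by rewrite distrC [X in _ * X]distrC; exact: H.
    move=> tt' [/= t0 ts -> d] [/= t'0 t's -> _].
    rewrite /last_coord !genextE ?good_sub//.
    have vv : t'^-1 <= t^-1 by rewrite lef_pV2.
    have h := generator_expanding hpsi n0 hgamma (good_sub t'0 t's)
      (lerB vv (lexx s)) s0.
    move: h; rewrite subrK => /(_ _ d) h.
    have p_le : psi (t^-1 - s) <= psi (t'^-1 - s).
      by rewrite -!(genextE psi) ?good_sub// genext_nincr// lerB.
    rewrite ler0_norm ?subr_le0// ler0_norm ?subr_le0// !opprB.
    set X := _ - psi (t^-1 - s) in h *.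
    have X0 : 0 <= X by rewrite subr_ge0.
    have K0 : 0 < k.+1%:R :> R by [].
    have E : t' - t = (t^-1 - t'^-1) * t * t'.
      by field; rewrite !gt_eqF.
    have h1 : t^-1 - t'^-1 <= k.+1%:R * s * X.
      move: h; rewrite opprD addrACA subrr addr0 -mulrA.
      by rewrite ler_pdivrMr// mulrC.
    have h2 : (t' - t) * s ^+ 2 <= t^-1 - t'^-1.
      rewrite E (_ : _ * _ * s ^+ 2 = (t^-1 - t'^-1) * ((t * s) * (t' * s)));
        last by ring.
      rewrite ler_piMr ?subr_ge0// mulr_ile1// ?mulr_ge0// ltW//.
    rewrite -(ler_pM2r (exprn_gt0 2 s0)) (le_trans h2)// (le_trans h1)//.
    by rewrite le_eqVlt; apply/orP; left; apply/eqP; field; rewrite gt_eqF.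
  by move=> [M [mM M0 sM]]; exists M; split => //; exact: gac.
have [_ g0 _] := hgamma.
apply: negligibleS (negligibleU (negligible_bigcup negk)
  (williamson_support hpsi n0 hgamma)).
move=> t [t0 ts Nt]; have [tg|tg] := leP (t^-1%:E) (gen_zero psi); last first.
  by right => -[_]; rewrite leNgt tg.
left.
have d0 : 0 < psi (t^-1 - s) - psi t^-1.
  by rewrite subr_gt0 psi_decr ?good_sub// ltrBlDr ltrDl.
have [k _ hk] := near_infty_natSinv_lt (PosNum d0).
exists k => //; exists (last_coord s t) => //; split => //.
by apply/ltW/hk => /=.
Qed.

Lemma radial_kernel_sing s : 0 < s -> singular_no_atoms gamma ->
  singular_no_atoms (radial_kernel s).
Proof.
move=> s0 [at0 [N [mN N0 gN]]]; split.
  move=> y; apply: radial_kernel_null => //.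
  (* By injectivity the fibre over [y] meets the support of gamma in at most one point, which gamma
     does not charge. *)
  have [[t1 [g1 e1]]|no] := pselect (exists t, good s t /\ last_coord s t = y).
    have n1 : gamma.-negligible [set t1] by exists [set t1]; split.
    apply: negligibleS (negligibleU n1 (williamson_support hpsi n0 hgamma)).
    move=> t [t0 ts ty]; have [tg|tg] := leP (t^-1%:E) (gen_zero psi); last first.
      by right => -[_]; rewrite leNgt tg.
    by left; apply: (last_coord_inj (ltW s0)) => //; rewrite e1.
  apply: negligibleS (williamson_support hpsi n0 hgamma).
  by move=> t [t0 ts ty] [_ tg]; apply: no; exists t.
pose rel k := [set p : R * R | [/\ p.1 = last_coord s p.2, k.+1%:R^-1 <= p.2,
  p.2 * s <= 1 & k.+1%:R^-1 <= p.2^-1 - s]].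
have negk k : (@lebesgue_measure R).-negligible
    [set y | exists2 t, N t & rel k (y, t)].
  (* One factor k+1 bounds the slope of psi beyond 1/(k+1); two more come from |1/t - 1/t'| = |t -
     t'| / (t t'). *)
  apply: (@negligible_lipschitz_rel _ (k.+1%:R ^+ 3)); last by exists N; split.
    exact: exprn_ge0.
  move=> y y' t t'; wlog : t t' y y' / t' <= t.
    move=> H h h'; have [tt'|/ltW tt'] := leP t' t; first exact: H.
    by rewrite distrC [X in _ * X]distrC; exact: H.
  move=> tt' [/= -> kt ts dt] [/= -> kt' t's dt'].
  have k0 : 0 < k.+1%:R^-1 :> R by rewrite invr_gt0.
  have t0 := lt_le_trans k0 kt; have t'0 := lt_le_trans k0 kt'.
  rewrite /last_coord !genextE ?good_sub//.
  have vv : t^-1 <= t'^-1 by rewrite lef_pV2.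
  have zz' : t^-1 - s <= t'^-1 - s by rewrite lerB.
  have h := generator_lipschitz hpsi n0 hgamma (lt_le_trans k0 dt) zz'.
  have p_le : psi (t'^-1 - s) <= psi (t^-1 - s).
    by rewrite -!(genextE psi) ?good_sub// genext_nincr.
  rewrite ger0_norm ?subr_ge0// ger0_norm ?subr_ge0//.
  set X := _ - psi (t'^-1 - s) in h *.
  have X0 : 0 <= X by rewrite subr_ge0.
  have K0 : 0 < k.+1%:R :> R by [].
  have h1 : k.+1%:R^-1 * X <= t'^-1 - t^-1.
    apply: le_trans (ler_wpM2r X0 dt) _; apply: (le_trans h).
    by rewrite opprD addrACA subrr addr0.
  have h2 : (t'^-1 - t^-1) * k.+1%:R^-1 ^+ 2 <= t - t'.
    have -> : t - t' = (t'^-1 - t^-1) * (t' * t) by field; rewrite !gt_eqF.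
    rewrite ler_wpM2l ?subr_ge0// expr2 ler_pM// ltW.
  have h3 := le_trans (ler_wpM2r (exprn_ge0 2 (ltW k0)) h1) h2.
  rewrite -(ler_pM2l (exprn_gt0 3 k0)) mulrA -exprMn mulVf ?gt_eqF//.
  rewrite expr1n mul1r; apply: le_trans h3; rewrite le_eqVlt; apply/orP; left.
  by apply/eqP; ring.
(* The point t = 1/s lies in none of the pieces, but its image is the single value psi(0) = 1. *)
have n1 : (@lebesgue_measure R).-negligible [set 1 : R].
  by exists [set 1]; split => //; exact: lebesgue_measure_set1.
have [M [mM M0 sM]] := negligibleU (negligible_bigcup negk) n1.
exists M; split => //; apply: radial_kernel_null; first exact: measurableC.
exists (~` N); split => //; first exact: measurableC.
move=> t [t0 ts Mt] Nt; apply: Mt; apply: sM.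
have := good_sub t0 ts; rewrite le_eqVlt => /predU1P[d0|d0].
  right; rewrite /= /last_coord -d0; exact: genext0.
left.
have [k1 _ hk1] := near_infty_natSinv_lt (PosNum d0).
have [k2 _ hk2] := near_infty_natSinv_lt (PosNum t0).
exists (maxn k1 k2) => //; exists t => //; split => //.
  by apply/ltW/hk2; exact: leq_maxr.
by apply/ltW/hk1; exact: leq_maxl.
Qed.

End radial_kernel.

(** * Measures on the unit cube *)

Section cube_measure_unique.
Context (R : realType) (n : nat).
Implicit Types (u x : n.-tuple R) (v y : R).

Definition lower_box u v : set (n.-tuple R * R) :=
  [set x | forall i, tnth x i <= tnth u i] `*` `]-oo, v].

Let G : set (set (n.-tuple R * R)) :=
  [set A | exists u v, A = lower_box u v].

Let const_tuple (r : R) : n.-tuple R := [tuple r | i < n].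

Let natbound (r : R) : exists N, forall k, (N <= k)%N -> r <= k%:R.
Proof.
exists (Num.truncn `|r|).+1 => k Nk; apply: (le_trans (ler_norm r)).
by apply: ltW; apply: lt_le_trans (Num.Theory.truncnS_gt _) _; rewrite ler_nat.
Qed.

Let tuple_bound x : exists N, forall k, (N <= k)%N -> forall i, tnth x i <= k%:R.
Proof.
have [N HN] := natbound (\sum_i `|tnth x i|).
exists N => k /HN h i; apply: le_trans h; apply: (le_trans (ler_norm _)).
by rewrite (bigD1 i)//= lerDl sumr_ge0.
Qed.

Lemma measurable_lower_tuple u :
  measurable [set x : n.-tuple R | forall i, tnth x i <= tnth u i].
Proof.
rewrite [X in measurable X](_ : _ =
    \bigcap_(i in [set: 'I_n]) ((fun x : n.-tuple R => tnth x i) @^-1` `]-oo, tnth u i])).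
  apply: fin_bigcap_measurable => // i _.
  rewrite -[X in measurable X]setTI; exact: measurable_tnth.
apply/seteqP; split => x /= h i; first by move=> _; rewrite /= in_itv/=.
by have := h i I; rewrite /= in_itv.
Qed.

(** A condition on one coordinate is a countable union of boxes whose other bounds are natural
    numbers. Hence all coordinates, and so the identity, are measurable for the generated
    sigma-algebra. *)
Let GE : (@measurable _ (n.-tuple R * R)%type) = <<s G>>.
Proof.
apply/seteqP; split; last first.
  apply: smallest_sub; first exact: sigma_algebra_measurable.
  move=> _ [u [v ->]]; apply: measurableX => //; exact: measurable_lower_tuple.
move=> A mA.
pose T' := g_sigma_algebraType G.
have mc (f : n.-tuple R * R -> R) : (forall r, exists F : nat -> set (n.-tuple R * R),
    (forall k, G (F k)) /\ f @^-1` `]-oo, r] = \bigcup_k F k) ->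
    measurable_fun [set: T'] (f : T' -> R).
  move=> Hf mD; apply: (measurability _ (RGenOInfty.measurableE R)) => //.
  move=> _ [_ [r ->] <-]; rewrite setTI -setCitvl preimage_setC.
  apply: measurableC; have [F [GF HF]] := Hf r.
  rewrite [X in measurable X](_ : _ = \bigcup_k F k)//.
  by apply: bigcupT_measurable => k; apply: sub_sigma_algebra; exact: GF.
have m2 : measurable_fun [set: T'] (fun p : T' => (p : n.-tuple R * R).2).
  apply: mc => r; exists (fun k => lower_box (const_tuple k%:R) r); split.
    by move=> k; exists (const_tuple k%:R), r.
  apply/seteqP; split => [[x y] /= yr|[x y] [k _ []]//].
  have [N HN] := tuple_bound x; exists N => //; split => //= i.
  by rewrite tnth_mktuple; exact: HN.
have m1 : measurable_fun [set: T'] (fun p : T' => (p : n.-tuple R * R).1).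
  apply/measurable_fun_tnthP => i; apply: mc => r.
  pose u k : n.-tuple R := [tuple if j == i then r else k%:R | j < n].
  exists (fun k => lower_box (u k) k%:R); split.
    by move=> k; exists (u k), k%:R.
  apply/seteqP; split => [[x y] /=|[x y] [k _ [/= h _]]]; last first.
    by have := h i; rewrite tnth_mktuple eqxx in_itv.
  rewrite in_itv/= => xr.
  have [N1 H1] := tuple_bound x; have [N2 H2] := natbound y.
  exists (maxn N1 N2) => //; split => /= [j|].
    by rewrite tnth_mktuple; case: eqP => [->//|_]; apply: H1; exact: leq_maxl.
  by rewrite in_itv/=; apply: H2; exact: leq_maxr.
have mid : measurable_fun [set: T'] (fun p : T' => (p : n.-tuple R * R)).
  have /= := measurable_fun_pair m1 m2.
  by congr measurable_fun; apply/funext => -[].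
by have := mid measurableT A mA; rewrite setTI.
Qed.

Let setIG : setI_closed G.
Proof.
move=> _ _ [u [v ->]] [u' [v' ->]].
exists [tuple Num.min (tnth u i) (tnth u' i) | i < n], (Num.min v v').
rewrite /lower_box -setXI; congr (_ `*` _).
  apply/seteqP; split => [x [/= h h'] i|x /= h].
    by rewrite tnth_mktuple le_min h h'.
  by split => i; have := h i; rewrite tnth_mktuple le_min => /andP[].
by apply/seteqP; split => [y [/=]|y /=]; rewrite !in_itv/= le_min; [move=> -> ->|move=> /andP].
Qed.

Lemma measurable_cube : measurable (@cube R n).
Proof.
rewrite [X in measurable X](_ : _ =
    \bigcap_(i in [set: 'I_n]) ((fun x : n.-tuple R => tnth x i) @^-1` `[0, 1])).
  apply: fin_bigcap_measurable => // i _.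
  rewrite -[X in measurable X]setTI; exact: measurable_tnth.
apply/seteqP; split => x /= h i; first by move=> _; rewrite /= in_itv/=.
by have := h i I; rewrite /= in_itv.
Qed.

(** The values are prescribed only for boxes anchored at 0 inside the cube. Intersected with the
    cube, which carries both measures, an unbounded box is either empty or such a box with bounds
    cut at 1. *)
Lemma cube_measure_unique (m1 m2 : {measure set (n.-tuple R * R) -> \bar R}) :
  m1 (~` (cube n `*` `[0, 1]%classic)) = 0 ->
  m2 (~` (cube n `*` `[0, 1]%classic)) = 0 ->
  (m1 setT < +oo)%E ->
  (forall x y, cube n x -> 0 <= y <= 1 ->
    m1 ([set x' | forall i, 0 <= tnth x' i <= tnth x i] `*` `[0, y]%classic) =
    m2 ([set x' | forall i, 0 <= tnth x' i <= tnth x i] `*` `[0, y]%classic)) ->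
  forall A, measurable A -> m1 A = m2 A.
Proof.
move=> m10 m20 m1fin m12.
have mCI : measurable (cube n `*` `[0, 1]%classic : set (n.-tuple R * R)).
  by apply: measurableX => //; exact: measurable_cube.
have mG (A : set (n.-tuple R * R)) : G A -> measurable A.
  by move=> GA; rewrite GE; exact: sub_sigma_algebra.
apply: (measure_unique G (fun k => lower_box (const_tuple k%:R) k%:R)) => //.
- by move=> k; exists (const_tuple k%:R), k%:R.
- apply/seteqP; split=> // -[x y] _.
  have [N1 H1] := tuple_bound x; have [N2 H2] := natbound y.
  exists (maxn N1 N2) => //; split => /= [j|].
    by rewrite tnth_mktuple; apply: H1; exact: leq_maxl.
  by rewrite in_itv/=; apply: H2; exact: leq_maxr.
- move=> A GA; have mA := mG _ GA.
  have split_m (m : {measure set (n.-tuple R * R) -> \bar R}) :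
      m (~` (cube n `*` `[0, 1]%classic)) = 0 ->
      m A = m (A `&` (cube n `*` `[0, 1]%classic)).
    move=> m0; rewrite -[in LHS](setUIDK A (cube n `*` `[0, 1]%classic)).
    rewrite measureU; [|exact: measurableI|exact: measurableD|]; last first.
      by apply/seteqP; split => // p [[_ h] [_]].
    rewrite [X in (_ + X)%E](_ : _ = 0) ?adde0//.
    apply: (subset_measure0 _ (measurableC mCI) _ m0); first exact: measurableD.
    by move=> p [].
  rewrite (split_m _ m10) (split_m _ m20).
  have [u [v AE]] := GA.
  have [uv|uv] := pselect ((forall i, 0 <= tnth u i) /\ 0 <= v); last first.
    suff -> : A `&` (cube n `*` `[0, 1]%classic) = set0 by rewrite !measure0.
    rewrite AE; apply/seteqP; split => // -[x y] [[/= xu yv] [/= cx cy]]; apply: uv.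
    move: yv cy; rewrite !in_itv/= => yv /andP[y0 y1]; split; last exact: le_trans yv.
    by move=> i; have /andP[x0 _] := cx i; exact: le_trans (xu i).
  have [u0 v0] := uv.
  pose u1 : n.-tuple R := [tuple Num.min (tnth u i) 1 | i < n].
  suff -> : A `&` (cube n `*` `[0, 1]%classic) =
      [set x' | forall i, 0 <= tnth x' i <= tnth u1 i] `*` `[0, Num.min v 1]%classic.
    apply: m12.
      by move=> i; rewrite tnth_mktuple le_min u0 ler01 ge_min lexx orbT.
    by rewrite le_min v0 ler01 ge_min lexx orbT.
  rewrite AE; apply/seteqP; split => -[x y].
    move=> [[/= xu yv] [/= cx cy]]; split => /= [i|].
      by rewrite tnth_mktuple le_min xu; case/andP: (cx i) => -> ->.
    by move: yv cy; rewrite !in_itv/= le_min => -> /andP[-> ->].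
  move=> [/= h]; rewrite in_itv/= le_min => /and3P[y0 yv y1].
  have hi i : [/\ 0 <= tnth x i, tnth x i <= tnth u i & tnth x i <= 1].
    by apply/and3P; have := h i; rewrite tnth_mktuple le_min.
  by split; split => /= [i|]; rewrite ?in_itv/= ?y0 ?yv ?y1//;
    have [h1 h2 h3] := hi i; rewrite ?h1.
- move=> k; apply: le_lt_trans m1fin; apply: le_measure; rewrite ?inE//.
  by apply: mG; exists (const_tuple k%:R), k%:R.
Qed.

End cube_measure_unique.

(** * The joint law *)

Section joint_law.
Context (R : realType) (psi : R -> R) (hpsi : archimedean_generator psi).
Context (n : nat) (n0 : (0 < n)%N).
Context (gamma : {sigma_finite_measure set R -> \bar R}).
Context (rho : {sigma_finite_measure set (n.-tuple R) -> \bar R}).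

Definition tsum (z : n.-tuple R) : R := \sum_(i < n) tnth z i.

Lemma measurable_tsum : measurable_fun setT tsum.
Proof. by apply: measurable_sum => i; exact: measurable_tnth. Qed.

Definition orthant : set (n.-tuple R) := [set z | forall i, 0 <= tnth z i].

Lemma measurable_orthant : measurable orthant.
Proof.
rewrite [X in measurable X](_ : _ =
    \bigcap_(i in [set: 'I_n]) ((fun x : n.-tuple R => tnth x i) @^-1` `[0, +oo[)).
  apply: fin_bigcap_measurable => // i _.
  rewrite -[X in measurable X]setTI; exact: measurable_tnth.
apply/seteqP; split => x /= h i; first by move=> _; rewrite /= in_itv/= andbT.
by have := h i I; rewrite /= in_itv/= andbT.
Qed.

Lemma tnth_le_tsum z i : orthant z -> tnth z i <= tsum z.
Proof. by move=> z0; rewrite /tsum (bigD1 i)//= lerDl sumr_ge0. Qed.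

Lemma tsum_ge0 z : orthant z -> 0 <= tsum z.
Proof. by move=> z0; exact: sumr_ge0. Qed.

Definition joint_density (p : n.-tuple R * R) : R :=
  \1_orthant p.1 * radial_weight n (tsum p.1) p.2.

Lemma joint_density_ge0 p : 0 <= joint_density p.
Proof. by rewrite mulr_ge0// radial_weight_ge0. Qed.

Lemma measurable_joint_density : measurable_fun setT joint_density.
Proof.
apply: measurable_funM.
  apply: measurableT_comp => //; apply: measurable_indic; exact: measurable_orthant.
apply: measurable_radial_weight => //.
exact: (measurableT_comp measurable_tsum).
Qed.

Definition gen_map (z : n.-tuple R) : n.-tuple R := map_tuple (genext psi) z.

Lemma measurable_gen_map : measurable_fun setT gen_map.
Proof.
apply/measurable_fun_tnthP => i.
rewrite (_ : _ \o _ = genext psi \o (fun z => tnth z i)); last first.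
  by apply/funext => z /=; rewrite tnth_map.
apply: measurableT_comp; [exact: measurable_genext|exact: measurable_tnth].
Qed.

Definition joint_map (p : n.-tuple R * R) : n.-tuple R * R :=
  (gen_map p.1, last_coord psi (tsum p.1) p.2).

Lemma measurable_joint_map : measurable_fun setT joint_map.
Proof.
apply/measurable_fun_pair; first exact: (measurableT_comp measurable_gen_map).
apply: measurable_last_coord => //.
exact: (measurableT_comp measurable_tsum).
Qed.

Definition joint_law : {measure set (n.-tuple R * R) -> \bar R} :=
  mpushforward (mdensity (rho \x gamma)%E measurable_joint_density joint_density_ge0)
    measurable_joint_map.

Local Open Scope ereal_scope.

Lemma integral_joint_law (F : n.-tuple R * R -> \bar R) :
  measurable_fun setT F -> (forall p, 0 <= F p) ->
  \int[joint_law]_p F p =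
  \int[(rho \x gamma)%E]_p (F (joint_map p) * (joint_density p)%:E).
Proof.
move=> mF F0; rewrite ge0_integral_mpushforward// integral_mdensity//.
by apply: measurableT_comp => //; exact: measurable_joint_map.
Qed.

Let mFw (F : n.-tuple R * R -> \bar R) : measurable_fun setT F ->
  measurable_fun setT (fun p => F (joint_map p) * (joint_density p)%:E).
Proof.
move=> mF; apply: emeasurable_funM.
  by apply: measurableT_comp => //; exact: measurable_joint_map.
by apply/measurable_EFinP; exact: measurable_joint_density.
Qed.

(** Disintegration by Tonelli: for fixed z the inner integral over t is the unnormalized kernel,
    which depends on z only through its sum. *)
Lemma integral_joint_law_kernel (f : n.-tuple R -> \bar R) (B : set R) :
  measurable_fun setT f -> (forall x, 0 <= f x) -> measurable B ->
  \int[joint_law]_p (f p.1 * (\1_B p.2)%:E) =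
  \int[rho]_z (f (gen_map z) * (\1_orthant z)%:E *
    radial_kernel hpsi n gamma (tsum z) B).
Proof.
move=> mf f0 mB.
have mF : measurable_fun setT (fun p : n.-tuple R * R => f p.1 * (\1_B p.2)%:E).
  apply: emeasurable_funM; first exact: (measurableT_comp mf).
  by apply/measurable_EFinP; apply: measurableT_comp => //; exact: measurable_indic.
rewrite integral_joint_law//; last by move=> p; rewrite mule_ge0// lee_fin.
rewrite fubini_tonelli1//=; [|exact: mFw mF|]; last first.
  by move=> p; rewrite !mule_ge0// ?lee_fin ?joint_density_ge0.
apply: eq_integral => z _; rewrite /fubini_F/= (radial_kernelE hpsi).
rewrite [X in _ * X]integral_mkcond -ge0_integralZl//=; first last.
- by rewrite mule_ge0// lee_fin.
- move=> t _; rewrite patchE; case: ifP => // _.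
  by rewrite lee_fin radial_weight_ge0.
- apply/(measurable_restrictT _ _).1.
    rewrite -[X in measurable X]setTI.
    exact: (measurable_last_coord hpsi (f := cst (tsum z)) (g := id)).
  apply: measurable_funTS; apply/measurable_EFinP.
  exact: (@measurable_radial_weight _ _ _ _ (cst (tsum z)) id).
apply: eq_integral => t _; rewrite patchE /joint_density/= indicE.
have -> : (t \in last_coord psi (tsum z) @^-1` B) = (last_coord psi (tsum z) t \in B).
  by apply/idP/idP => /set_mem h; exact/mem_set.
case: ifP => _; last by rewrite mule0 mul0e mule0.
by rewrite mule1 EFinM muleA.
Qed.

Context (hgamma : williamson_measure psi n.+1 gamma).
Context (rhoE : forall f, measurable_fun setT f -> (forall x, 0 <= f x) ->
  \int[rho]_x f x = lebint f).

Lemma psi_ext_sum_y (lv : 'I_n -> \bar R) (lvy : \bar R) :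
  (forall i, 0 <= lv i) -> 0 <= lvy ->
  (exists i, lv i = +oo) \/ lvy = +oo ->
  psi_ext psi (\sum_(i < n) lv i + lvy) = 0%R.
Proof.
move=> lv0 lvy0 oo; suff -> : \sum_(i < n) lv i + lvy = +oo by [].
have s0 : 0 <= \sum_(i < n) lv i by exact: sume_ge0.
case: oo => [[i oi]|->]; last by rewrite addey// gt_eqF// (lt_le_trans _ s0).
rewrite (_ : \sum_(i < n) lv i = +oo) ?addye// ?gt_eqF// ?(lt_le_trans _ lvy0)//.
rewrite (bigD1 i)//= oi addye// gt_eqF//.
by apply: (@lt_le_trans _ _ 0) => //; exact: sume_ge0.
Qed.

Lemma joint_law_cdf x y : cube n x -> (0 <= y <= 1)%R ->
  joint_law ([set x' | forall i, 0 <= tnth x' i <= tnth x i]%R `*` `[0%R, y]%classic) =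
  (arch_copula psi x y)%:E.
Proof.
move=> cx y01; have /andP[y0 y1] := y01.
set box := (X in joint_law X).
have mbox : measurable box.
  apply: measurableX => //.
  rewrite [X in measurable X](_ : _ = \bigcap_(i in [set: 'I_n])
    ((fun x : n.-tuple R => tnth x i) @^-1` `[0%R, tnth x i])).
    apply: fin_bigcap_measurable => // i _.
    rewrite -[X in measurable X]setTI; exact: measurable_tnth.
  apply/seteqP; split => x' /= h i; first by move=> _; rewrite /= in_itv/=.
  by have := h i I; rewrite /= in_itv.
have mbox1 : measurable_fun setT (fun p => (\1_box p)%:E : \bar R).
  by apply/measurable_EFinP; exact: measurable_indic.
have box0 (p : n.-tuple R * R) : 0 <= (\1_box p)%:E :> \bar R by rewrite lee_fin.
rewrite -[X in joint_law X]setIT -integral_indic// integral_joint_law//.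
rewrite fubini_tonelli2//=; [|exact: (mFw mbox1)|]; last first.
  by move=> p; rewrite !mule_ge0// lee_fin joint_density_ge0.
rewrite /fubini_G/=.
pose lv i := level_inf psi (tnth x i); pose lvy := level_inf psi y.
have lv0 i : 0 <= lv i by exact: level_inf_ge0.
have lvy0 : 0 <= lvy by exact: level_inf_ge0.
have boxP z t : orthant z -> (0 < t)%R -> (t * tsum z <= 1)%R ->
    box (joint_map (z, t)) <->
    (forall i, lv i <= (tnth z i)%:E) /\ lvy <= (t^-1 - tsum z)%:E.
  move=> z0 t0 ts.
  have d0 : (0 <= t^-1 - tsum z)%R.
    by rewrite subr_ge0 -(ler_pM2l t0) divff ?gt_eqF.
  rewrite /box /joint_map /=; split => [[/= h1]|[h1 h2]].
    rewrite in_itv/= => /andP[_]; rewrite /last_coord genextE// => h2.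
    split; last by rewrite /lvy level_infP.
    move=> i; rewrite /lv level_infP//; have /andP[_] := h1 i.
    by rewrite tnth_map genextE.
  split => /= [i|].
    rewrite tnth_map; apply/andP; split; first by case/andP: (genext_itv hpsi (tnth z i)).
    rewrite genextE; last exact: z0.
    rewrite -(level_infP hpsi (cx i) (z0 i)); exact: h1.
  rewrite in_itv/=; apply/andP; split.
    by case/andP: (genext_itv hpsi (t^-1 - tsum z)).
  by rewrite /last_coord genextE// -(level_infP hpsi y01 d0).
have integrand0 z t : ~ (orthant z /\ (0 < t)%R /\ (t * tsum z <= 1)%R) ->
    joint_density (z, t) = 0%R.
  rewrite /joint_density/= /radial_weight indicE => h.
  case: (boolP (z \in orthant)) => [/set_mem zO|_]; last by rewrite mul0r.
  by case: ifP; rewrite ?mulr0// => /andP[t0 ts]; exfalso; apply: h.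
(* An infinite pseudo-inverse occurs for the value 0 when psi has no zero; the box is then null and
   [psi_ext] returns 0 at +oo. *)
have [oo|fin] := pselect ((exists i, lv i = +oo) \/ lvy = +oo).
  rewrite /arch_copula psi_ext_sum_y// integral0_eq// => t _.
  rewrite integral0_eq// => z _.
  have [h|/integrand0 ->] := pselect (orthant z /\ (0 < t)%R /\ (t * tsum z <= 1)%R);
    last by rewrite mule0.
  have [zO [t0 ts]] := h.
  rewrite indicE memNset ?mul0e// => /(boxP _ _ zO t0 ts) [h1 h2].
  case: oo => [[i oi]|oy].
    by have := h1 i; rewrite oi leye_eq.
  by move: h2; rewrite oy leye_eq.
have lvfin i : lv i \is a fin_num.
  rewrite ge0_fin_numE// ltey; apply/negP => /eqP oi; apply: fin; left; by exists i.
have lvyfin : lvy \is a fin_num.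
  by rewrite ge0_fin_numE// ltey; apply/negP => /eqP oi; apply: fin; right.
pose a : n.-tuple R := [tuple fine (lv i) | i < n].
pose b := fine lvy.
have aE i : lv i = (tnth a i)%:E by rewrite tnth_mktuple fineK.
have bE : lvy = b%:E by rewrite fineK.
have a0 i : (0 <= tnth a i)%R by rewrite -lee_fin -aE.
have b0 : (0 <= b)%R by rewrite -lee_fin -bE.
have -> : arch_copula psi x y = psi (tsum a + b).
  rewrite /arch_copula /pseudo_inv -/lvy bE.
  rewrite (eq_bigr (fun i => (tnth a i)%:E)) => [|i _]; last exact: aE.
  by rewrite sumEFin.
have ab0 : (0 <= tsum a + b)%R by rewrite addr_ge0 ?tsum_ge0.
rewrite (williamson_integral hpsi hgamma ab0).
(* For fixed t > 0 the box is the simplex with corner [a] and bound 1/t - b. The density n! t^n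
   turns its volume (1/t - b - sum a)^n / n! into (1 - t (sum a + b))^n. *)
have inner t : \int[rho]_z ((\1_box (joint_map (z, t)))%:E * (joint_density (z, t))%:E) =
    if (0 < t)%R then ((Num.max (1 - t * (tsum a + b)) 0) ^+ n)%:E else 0.
  case: ltP => [t0|t0]; last first.
    rewrite integral0_eq// => z _; rewrite integrand0 ?mule0// => -[_ []].
    by rewrite ltNge t0.
  have mab : measurable (above_below a (t^-1 - b)%R).
    rewrite [X in measurable X](_ : _ = (\bigcap_(i in [set: 'I_n])
      ((fun x : n.-tuple R => tnth x i) @^-1` `[tnth a i, +oo[)) `&`
      (tsum @^-1` `]-oo, (t^-1 - b)%R])).
      apply: measurableI.
        apply: fin_bigcap_measurable => // i _.
        rewrite -[X in measurable X]setTI; exact: measurable_tnth.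
      by rewrite -[X in measurable X]setTI; exact: measurable_tsum.
    apply/seteqP; split => z /=; rewrite in_itv/= => -[h1 h2]; split => // i.
      by move=> _; rewrite /= in_itv/= andbT.
    by have := h1 i I; rewrite /= in_itv/= andbT.
  transitivity (\int[rho]_z ((n`!%:R * t ^+ n)%:E * (\1_(above_below a (t^-1 - b)) z)%:E)).
    apply: eq_integral => z _.
    have [h|h] := pselect (orthant z /\ (0 < t)%R /\ (t * tsum z <= 1)%R); last first.
      rewrite integrand0// mule0 indicE memNset ?mule0// => -[h1 h2]; apply: h.
      have zO : orthant z by move=> i; exact: le_trans (h1 i).
      split => //; split => //; rewrite -ler_pdivlMl// mulr1.
      by apply: (le_trans h2); rewrite gerBl.
    have [zO [_ ts]] := h.
    have oE : \1_orthant z = 1%R :> R by rewrite indicE mem_set.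
    rewrite /joint_density/= /radial_weight t0 ts/= oE mul1r muleC.
    congr (_ * _%:E); rewrite !indicE; congr (_%:R); congr nat_of_bool.
    apply/idP/idP => /set_mem.
      move=> /(boxP _ _ zO t0 ts)[h1 h2]; apply/mem_set; split => [i|].
        by rewrite -lee_fin -aE.
      by rewrite lerBrDl -lerBrDr -lee_fin -bE.
    move=> [h1 h2]; apply/mem_set/(boxP _ _ zO t0 ts); split => [i|].
      by rewrite aE lee_fin.
    by rewrite bE lee_fin lerBrDr -lerBrDl.
  rewrite ge0_integralZl//; first last.
  - by rewrite lee_fin mulr_ge0// exprn_ge0// ltW.
  - by apply/measurable_EFinP; exact: measurable_indic.
  rewrite rhoE//; last by apply/measurable_EFinP; exact: measurable_indic.
  rewrite simplex_volume -EFinM; congr (_%:E); rewrite -/(tsum a).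
  have f0 : (n`!%:R : R) != 0%R by rewrite pnatr_eq0 -lt0n fact_gt0.
  have tE : (1 - t * (tsum a + b) = t * (t^-1 - b - tsum a))%R.
    by field; rewrite gt_eqF.
  case: ifP => ab.
    have ab' : (0 <= t^-1 - b - tsum a)%R by rewrite subr_ge0.
    rewrite max_l; last by rewrite tE mulr_ge0// ltW.
    by rewrite tE exprMn; field.
  rewrite mulr0 max_r ?expr0n ?gtn_eqF// tE.
  by rewrite pmulr_rle0// subr_le0 ltW// ltNge ab.
under eq_integral do rewrite inner.
have mW : measurable_fun setT
    (fun t : R => ((Num.max (1 - t * (tsum a + b)) 0) ^+ n)%:E : \bar R).
  apply/measurable_EFinP; apply: measurable_funX; apply: measurable_maxr => //.
  by apply: measurable_funB => //; exact: measurable_funM.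
have [_ g0 _] := hgamma.
apply: ge0_ae_eq_integral => //.
- apply: measurable_fun_ifT => //; exact: measurable_fun_ltr.
- move=> t _; case: ifP => // _; rewrite lee_fin exprn_ge0//.
  by rewrite le_max lexx orbT.
- by move=> t _; rewrite lee_fin exprn_ge0// le_max lexx orbT.
exists `]-oo, 0%R]%classic; split => // t /= h; rewrite in_itv/= leNgt.
by apply/negP => t0; apply: h => _; rewrite t0.
Qed.

Lemma joint_law_cube : joint_law (~` (cube n `*` `[0%R, 1%R]%classic)) = 0.
Proof.
rewrite /joint_law mpushforwardE (_ : _ @^-1` _ = set0) ?measure0//.
apply/seteqP; split => // p; apply; split => /= [i|].
  by rewrite tnth_map; exact: genext_itv.
by rewrite in_itv/=; exact: genext_itv.
Qed.

End joint_law.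

(** * Parts of a decomposed measure *)

Section decomposition.
Context (R : realType).
Local Open Scope ereal_scope.

Lemma countable_no_atoms (m : {measure set R -> \bar R}) (S : set R) :
  (forall t, m [set t] = 0) -> countable S -> m S = 0.
Proof.
move=> m0 cS; have mS : measurable S by exact: countable_measurable.
have /countable_injP[f injf] := cS.
apply: measure_negligible => //.
pose g := 'pinv_(fun=> 0%R) S f.
have : m.-negligible (\bigcup_k [set g k]).
  by apply: negligible_bigcup => k; exists [set g k]; split.
apply: negligibleS => t St; exists (f t) => //=.
by rewrite /g pinvKV ?inE.
Qed.

Lemma null_setC_eq (m : {measure set R -> \bar R}) (B : set R) :
  measurable B -> m (~` B) = 0 -> m B = m setT.
Proof.
move=> mB m0; have -> : m setT = m (~` B) + m B.
  by rewrite -(setvU B); apply: measureU => //; [exact: measurableC|exact: setICl].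
by rewrite m0 add0e.
Qed.

Lemma measureT_eq0 (m : {measure set R -> \bar R}) (B : set R) :
  measurable B -> m B = 0 -> m (~` B) = 0 -> m setT = 0.
Proof. by move=> mB mB0 mBC0; rewrite -(null_setC_eq mB mBC0). Qed.

Context (k kd ks ka : {measure set R -> \bar R}).
Context (decomp : forall B, measurable B -> k B = kd B + ks B + ka B).
Context (hd : discrete_measure kd) (hs : singular_no_atoms ks)
  (ha : abs_continuous ka).

Let kd_null B : measurable B -> k B = 0 -> kd B = 0.
Proof.
move=> mB; rewrite decomp// => /eqP; rewrite padde_eq0//; last by rewrite adde_ge0.
by rewrite padde_eq0// => /andP[/andP[/eqP]].
Qed.

Let ks_null B : measurable B -> k B = 0 -> ks B = 0.
Proof.
move=> mB; rewrite decomp// => /eqP; rewrite padde_eq0//; last by rewrite adde_ge0.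
by rewrite padde_eq0// => /andP[/andP[_ /eqP]].
Qed.

Let ka_null B : measurable B -> k B = 0 -> ka B = 0.
Proof.
move=> mB; rewrite decomp// => /eqP; rewrite padde_eq0//; last by rewrite adde_ge0.
by move=> /andP[_ /eqP].
Qed.

Let le_setT (m : {measure set R -> \bar R}) B : measurable B -> m setT = 0 -> m B = 0.
Proof.
by move=> mB; apply: subset_measure0.
Qed.

(** The discrete and singular parts are carried by Lebesgue-null sets. These are null for [k], hence
    for its parts, so both parts vanish. *)
Lemma decomposition_ac B : measurable B ->
  (forall N, measurable N -> @lebesgue_measure R N = 0 -> k N = 0) -> ka B = k B.
Proof.
move=> mB kac; rewrite decomp//.
have [S [cS S0]] := hd; have mS : measurable S by exact: countable_measurable.
have S_null := kac _ mS (countable_lebesgue_measure0 cS).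
have kdT := measureT_eq0 mS (kd_null mS S_null) S0.
have [_ [N [mN N0 NC0]]] := hs.
have ksT := measureT_eq0 mN (ks_null mN (kac _ mN N0)) NC0.
by rewrite (le_setT mB kdT) (le_setT mB ksT) !add0e.
Qed.

(** A countable set carries [k] and therefore all its parts, but neither the atomless nor the
    absolutely continuous part charges it. *)
Lemma decomposition_discrete B : measurable B -> discrete_measure k -> kd B = k B.
Proof.
move=> mB [S [cS S0]]; rewrite decomp//.
have mS : measurable S by exact: countable_measurable.
have mSC := measurableC mS.
have [ks_at _] := hs.
have ksT := measureT_eq0 mS (countable_no_atoms ks_at cS) (ks_null mSC S0).
have /null_content_dominatesP ha' := ha.
have kaT := measureT_eq0 mS (ha' _ mS (countable_lebesgue_measure0 cS)) (ka_null mSC S0).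
by rewrite (le_setT mB ksT) (le_setT mB kaT) !adde0.
Qed.

Lemma decomposition_singular B : measurable B -> singular_no_atoms k -> ks B = k B.
Proof.
move=> mB [k_at [N [mN N0 NC0]]]; rewrite decomp//.
have [S [cS S0]] := hd; have mS : measurable S by exact: countable_measurable.
have kdT := measureT_eq0 mS (kd_null mS (countable_no_atoms k_at cS)) S0.
have /null_content_dominatesP ha' := ha.
have kaT := measureT_eq0 mN (ha' _ mN N0) (ka_null (measurableC mN) NC0).
by rewrite (le_setT mB kdT) (le_setT mB kaT) add0e adde0.
Qed.

End decomposition.

(** * Uniqueness of finite measures from rational rays *)

Section rational_rays.
Context (R : realType).

(* Almost sure identities of kernels are only available simultaneously for
   countably many sets, hence the restriction to rational rays. *)
Lemma measure_unique_rat (m1 m2 : {measure set R -> \bar R}) :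
  (m1 setT < +oo)%E ->
  (forall q : rat, m1 `]-oo, ratr q]%classic = m2 `]-oo, ratr q]%classic) ->
  forall B, measurable B -> m1 B = m2 B.
Proof.
move=> m1fin m12.
pose G : set (set R) := [set A | exists q : rat, A = `]-oo, ratr q]%classic].
have GE : (@measurable _ R) = <<s G>>.
  apply/seteqP; split; last first.
    by apply: smallest_sub; [exact: sigma_algebra_measurable|move=> _ [q ->]].
  move=> A mA; pose T' := g_sigma_algebraType G.
  have mid : measurable_fun [set: T'] (fun x : T' => (x : R)).
    move=> mD; apply: (measurability _ (RGenOInfty.measurableE R)) => //.
    move=> _ [_ [r ->] <-]; rewrite setTI.
    rewrite [X in measurable X](_ : _ =
        \bigcup_q if r < ratr q then ~` `]-oo, (ratr q : R)]%classic else set0).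
      apply: bigcupT_measurable_rat => q; case: ifP => // _; apply: measurableC.
      by apply: sub_sigma_algebra; exists q.
    apply/seteqP; split => [x|x [q _]] /=; last case: ifP => // rq.
      rewrite in_itv/= andbT => rx; have [q] := rat_in_itvoo rx.
      rewrite in_itv/= => /andP[rq qx]; exists q => //=; rewrite rq /=.
      by rewrite in_itv/=; apply/negP; rewrite -ltNge.
    by rewrite /= !in_itv/= andbT => /negP; rewrite -ltNge; exact: lt_trans.
  by have := mid measurableT A mA; rewrite setTI.
apply: (measure_unique G (fun k => `]-oo, (ratr k%:R : R)]%classic)) => //.
- move=> _ _ [p ->] [q ->]; exists (Num.min p q).
  apply/seteqP; split => x /=; rewrite !in_itv/=.
    by move=> [xp xq]; case: (leP p q).
  by case: (leP p q) => pq h; split => //; apply: (le_trans h); rewrite ler_rat// ltW.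
- by move=> k; exists k%:R.
- apply/seteqP; split=> // x _; exists (Num.truncn `|x|).+1 => //=.
  rewrite in_itv/= ratr_nat; apply: (le_trans (ler_norm _)).
  exact/ltW/Num.Theory.truncnS_gt.
- by move=> _ [q ->].
- by move=> k; apply: le_lt_trans m1fin; apply: le_measure; rewrite ?inE.
Qed.

End rational_rays.

(** * Identification of the Markov kernel *)

Section kernel_identification.
Context (R : realType) (psi : R -> R) (hpsi : archimedean_generator psi).
Context (n : nat) (n0 : (0 < n)%N).
Context (gamma : {sigma_finite_measure set R -> \bar R}).
Context (hgamma : williamson_measure psi n.+1 gamma).
Context (rho : {sigma_finite_measure set (n.-tuple R) -> \bar R}).
Local Open Scope ereal_scope.
Context (rhoE : forall f, measurable_fun setT f -> (forall x, 0 <= f x) ->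
  \int[rho]_x f x = lebint f).
Context (mu : {measure set (n.-tuple R * R) -> \bar R}).
Context (hmu : copula_measure_of psi mu).
Context (K : R.-pker (n.-tuple R) ~> R) (hK : markov_kernel_of mu K).

Let law := joint_law hpsi gamma rho.
Let kappa := radial_kernel hpsi n gamma.

Lemma copula_measure_joint_law A : measurable A -> mu A = law A.
Proof.
have [muT muC mu_cdf] : [/\ mu setT = 1, mu (~` (cube n `*` `[0%R, 1%R]%classic)) = 0 &
  forall x y, @cube R n x -> (0 <= y <= 1)%R ->
    mu ([set x' | forall i, (0 <= tnth x' i <= tnth x i)%R] `*` `[0%R, y]%classic)
      = (arch_copula psi x y)%:E] by case: hmu => ? [].
apply: cube_measure_unique => //.
- exact: joint_law_cube.
- by rewrite muT ltry.
- by move=> x y cx y01; rewrite mu_cdf// /law joint_law_cdf.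
Qed.

Lemma integral_copula_measure (F : n.-tuple R * R -> \bar R) :
  \int[mu]_p F p = \int[law]_p F p.
Proof. by apply: eq_measure_integral => A mA _; exact: copula_measure_joint_law. Qed.

Let indic1 (A : set (n.-tuple R)) (B : set R) (p : n.-tuple R * R) :
  (\1_(A `*` B) p)%:E = (\1_A p.1)%:E * (\1_B p.2)%:E :> \bar R.
Proof.
rewrite -EFinM !indicE -natrM mulnb; congr (_%:R)%:E; congr nat_of_bool.
by apply/idP/andP => [/set_mem[? ?]|[/set_mem ? /set_mem ?]]; [split|]; exact/mem_set.
Qed.

Lemma copula_measure_prod A B : measurable A -> measurable B ->
  mu (A `*` B) = \int[rho]_z ((\1_A (gen_map psi z))%:E *
    (\1_(@orthant R n) z)%:E * kappa (tsum z) B).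
Proof.
move=> mA mB; have mAB : measurable (A `*` B) by exact: measurableX.
rewrite -[X in mu X]setIT -integral_indic// integral_copula_measure.
under eq_integral do rewrite indic1.
rewrite /law (@integral_joint_law_kernel _ _ hpsi _ gamma rho (fun x => (\1_A x)%:E))//.
by apply/measurable_EFinP; exact: measurable_indic.
Qed.

(** K(x, B) depends on x alone, so integrating it sees only the law of z, whose density on the
    orthant is the total mass of the unnormalized kernel. *)
Lemma copula_measure_kernel A B : measurable A -> measurable B ->
  mu (A `*` B) = \int[rho]_z ((\1_A (gen_map psi z))%:E * K (gen_map psi z) B *
    (\1_(@orthant R n) z)%:E * kappa (tsum z) setT).
Proof.
move=> mA mB; rewrite hK// integral_mkcond.
transitivity (\int[mu]_p (((\1_A p.1)%:E * K p.1 B) * (\1_[set: R] p.2)%:E)).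
  apply: eq_integral => p _; rewrite patchE indicT mule1 indicE.
  have -> : (p \in A `*` [set: R]) = (p.1 \in A).
    by apply/idP/idP => /set_mem h; apply/mem_set; [case: h|split].
  by case: ifP; rewrite ?mul1e ?mul0e.
rewrite integral_copula_measure /law.
rewrite (@integral_joint_law_kernel _ _ hpsi _ gamma rho (fun x => (\1_A x)%:E * K x B))//.
apply: emeasurable_funM; last exact: measurable_kernel.
by apply/measurable_EFinP; exact: measurable_indic.
Qed.

Lemma measurable_kappa B : measurable B ->
  measurable_fun setT (fun z : n.-tuple R => kappa (tsum z) B).
Proof.
move=> mB.
pose f (p : n.-tuple R * R) : \bar R :=
  (\1_B (last_coord psi (tsum p.1) p.2) * radial_weight n (tsum p.1) p.2)%:E.
have mt : measurable_fun setT (fun p : n.-tuple R * R => tsum p.1).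
  exact: (measurableT_comp (@measurable_tsum R n)).
have mf : measurable_fun setT f.
  apply/measurable_EFinP; apply: measurable_funM.
    apply: measurableT_comp; first exact: measurable_indic.
    exact: measurable_last_coord.
  exact: measurable_radial_weight.
have f0 p : 0 <= f p by rewrite lee_fin mulr_ge0// radial_weight_ge0.
have := measurable_fun_fubini_tonelli_F (m2 := gamma) f mf f0.
congr measurable_fun; apply/funext => z.
rewrite /fubini_F /kappa (radial_kernelE hpsi) [RHS]integral_mkcond.
apply: eq_integral => t _; rewrite patchE /f/= indicE.
have -> : (t \in last_coord psi (tsum z) @^-1` B) = (last_coord psi (tsum z) t \in B).
  by apply/idP/idP => /set_mem h; exact/mem_set.
by case: ifP; rewrite ?mul1r ?mul0r.
Qed.

Let ginv (x : n.-tuple R) : n.-tuple R := map_tuple (gen_inv psi) x.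

Let mginv : measurable_fun setT ginv.
Proof.
apply/measurable_fun_tnthP => i.
rewrite (_ : _ \o _ = gen_inv psi \o (fun z => tnth z i)); last first.
  by apply/funext => z /=; rewrite tnth_map.
apply: measurableT_comp; [exact: measurable_gen_inv|exact: measurable_tnth].
Qed.

(** Positive mass requires some t in the support with t s <= 1, whence s <= 1/t is at most the first
    zero. Each z_i is then too, and z can be recovered from psi(z). *)
Lemma kappa_le_gen_zero (z : n.-tuple R) : orthant z -> kappa (tsum z) setT != 0 ->
  (tsum z)%:E <= gen_zero psi.
Proof.
move=> zO; apply: contraR; rewrite -ltNge => zs.
apply/eqP; apply: radial_kernel_null => //.
apply: negligibleS (williamson_support hpsi n0 hgamma).
move=> t [t0 ts _] [_]; apply/negP; rewrite -ltNge; apply: (lt_le_trans zs).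
by rewrite lee_fin -(ler_pM2l t0) divff ?gt_eqF.
Qed.

Let gen_mapK (z : n.-tuple R) : orthant z -> kappa (tsum z) setT != 0 ->
  ginv (gen_map psi z) = z.
Proof.
move=> zO zk; apply: eq_from_tnth => i; rewrite !tnth_map genextE//.
rewrite gen_invK//; apply: le_trans (kappa_le_gen_zero zO zk).
by rewrite lee_fin tnth_le_tsum.
Qed.

Let kappa0 (z : n.-tuple R) B : measurable B -> kappa (tsum z) setT = 0 ->
  kappa (tsum z) B = 0.
Proof. by move=> mB; apply: subset_measure0. Qed.

(** Two expressions for the same mu-mass agree over every measurable set of z, and the first
    integrand is integrable because mu is finite. The exceptional null set still depends on [B]. *)
Lemma kernel_identification_ae B : measurable B ->
  {ae rho, forall z, (\1_(@orthant R n) z)%:E * kappa (tsum z) B =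
    K (gen_map psi z) B * (\1_(@orthant R n) z)%:E * kappa (tsum z) setT}.
Proof.
move=> mB.
pose F z := (\1_(@orthant R n) z)%:E * kappa (tsum z) B.
pose H z := K (gen_map psi z) B * (\1_(@orthant R n) z)%:E * kappa (tsum z) setT.
have mO : measurable_fun setT (fun z : n.-tuple R => (\1_(@orthant R n) z)%:E : \bar R).
  by apply/measurable_EFinP; apply: measurable_indic; exact: measurable_orthant.
have mF : measurable_fun setT F by apply: emeasurable_funM => //; exact: measurable_kappa.
have mKg : measurable_fun setT (fun z => K (gen_map psi z) B).
  apply: (measurableT_comp (f := K ^~ B)); first exact: measurable_kernel.
  exact: measurable_gen_map.
have mH : measurable_fun setT H.
  by apply: emeasurable_funM; [exact: emeasurable_funM|exact: measurable_kappa].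
have F0 z : 0 <= F z by rewrite mule_ge0// lee_fin.
have muT : mu setT = 1 by case: hmu.
have iF : rho.-integrable setT F.
  apply/integrableP; split => //.
  rewrite (eq_integral F) => [|z _]; last by rewrite gee0_abs.
  have -> : \int[rho]_z F z = mu ([set: n.-tuple R] `*` B).
    rewrite copula_measure_prod//; apply: eq_integral => z _.
    by rewrite indicT mul1e.
  apply: (@le_lt_trans _ _ (mu setT)); last by rewrite muT ltry.
  by apply: le_measure; rewrite ?inE//; exact: measurableX.
have : ae_eq rho setT F H.
  apply: integral_ae_eq => // E _ mE.
  pose A := ginv @^-1` E.
  have mA : measurable A by rewrite -[X in measurable X]setTI; exact: mginv.
  have AE z : orthant z -> kappa (tsum z) setT != 0 -> (gen_map psi z \in A) = (z \in E).
    by move=> zO zk; apply/idP/idP => /set_mem h; apply/mem_set;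
      move: h; rewrite /A /= gen_mapK.
  (* [gen_inv] turns a condition on z into a condition on the conditioning
     variable psi(z), so that the defining property of K applies. *)
  transitivity (mu (A `*` B)).
    rewrite copula_measure_prod// integral_mkcond; apply: eq_integral => z _.
    rewrite patchE /F !indicE.
    case: (boolP (z \in @orthant R n)) => [/set_mem zO|_]; last first.
      by rewrite !mul0e mule0 mul0e; case: ifP.
    have [k0|k0] := eqVneq (kappa (tsum z) setT) 0.
      by rewrite kappa0// !mule0; case: ifP.
    by rewrite AE//; case: ifP; rewrite ?mul1e ?mul0e// mule1.
  rewrite copula_measure_kernel// [RHS]integral_mkcond; apply: eq_integral => z _.
  rewrite patchE /H !indicE.
  case: (boolP (z \in @orthant R n)) => [/set_mem zO|_]; last first.
    by rewrite !mule0 !mul0e; case: ifP.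
  have [->|k0] := eqVneq (kappa (tsum z) setT) 0.
    by rewrite !mule0; case: ifP.
  by rewrite AE//; case: ifP; rewrite ?mul1e ?mul0e.
by apply: filterS => z /(_ I).
Qed.

(** The exceptional points form a simplex of edge length 0, whose volume is 0 because n > 0. *)
Lemma tsum_gt0_ae : {ae rho, forall z : n.-tuple R, orthant z -> (0 < tsum z)%R}.
Proof.
pose o : n.-tuple R := [tuple 0%R | i < n].
have o0 i : tnth o i = 0%R by rewrite tnth_mktuple.
have sE : (\sum_i tnth o i = 0)%R by apply: big1.
have mab : measurable (above_below o 0%R).
  rewrite [X in measurable X](_ : _ = @orthant R n `&` ((@tsum R n) @^-1` `]-oo, 0%R])).
    apply: measurableI; first exact: measurable_orthant.
    by rewrite -[X in measurable X]setTI; exact: measurable_tsum.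
  apply/seteqP; split => z /=; rewrite in_itv/= => -[h1 h2]; split => // i.
    by have := h1 i; rewrite o0.
  by rewrite o0; exact: h1.
exists (above_below o 0%R); split => //.
  rewrite -[X in rho X]setIT -integral_indic// rhoE; first last.
  - by move=> z; rewrite lee_fin.
  - by apply/measurable_EFinP; exact: measurable_indic.
  by rewrite simplex_volume sE lexx subr0 expr0n gtn_eqF// mul0r.
move=> z /= /not_implyP[zO]; move/negP; rewrite -leNgt => zs.
by split => // i; rewrite o0; exact: zO.
Qed.

Lemma kernel_identification : {ae rho, forall z : n.-tuple R, orthant z ->
  kappa (tsum z) setT != 0 -> (0 < tsum z)%R /\ forall B, measurable B ->
    kappa (tsum z) B = K (gen_map psi z) B * kappa (tsum z) setT}.
Proof.
(* Enumerates the rationals, with value 0 at indices that encode none, so that one null set serves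
   all rational rays. *)
pose q k : rat := odflt 0%R (choice.unpickle k).
have aeq := ae_foralln (fun k => @kernel_identification_ae `]-oo, ratr (q k)]%classic
  (measurable_itv _)).
apply: filterS2 tsum_gt0_ae aeq => z s0 zq zO zk; split; first exact: s0.
have kfin : kappa (tsum z) setT < +oo := radial_kernel_fin hpsi hgamma (s0 zO).
have kfn : kappa (tsum z) setT \is a fin_num by rewrite ge0_fin_numE.
have r0 : (0 <= fine (kappa (tsum z) setT))%R by rewrite fine_ge0.
pose m2 : {measure set R -> \bar R} := mscale (NngNum r0) (K (gen_map psi z)).
have m2E B : m2 B = K (gen_map psi z) B * kappa (tsum z) setT.
  by rewrite /m2 /= /mscale/= fineK// muleC.
move=> B mB; rewrite -m2E; apply: measure_unique_rat => // r.
have := zq (choice.pickle r); rewrite /q choice.pickleK /= indicE mem_set//.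
by rewrite mul1e mule1 m2E.
Qed.

End kernel_identification.

(** * Mass of one part of the kernel on the cube *)

Section mu_star.
Context (R : realType) (n : nat) (mu : {measure set (n.-tuple R * R) -> \bar R}).
Context (c : n.-tuple R -> R) (hc : marginal_density mu c).
Context (Kstar : R.-spker (n.-tuple R) ~> R).
Local Open Scope ereal_scope.

Let full (x : n.-tuple R) := Kstar x `[0%R, 1%R]%classic = 1.

Lemma measurable_full : measurable (cube n `&` [set x | full x]).
Proof.
apply: measurableI; first exact: measurable_cube.
rewrite -[X in measurable X]setTI.
exact: (measurable_kernel Kstar `[0%R, 1%R]%classic (measurable_itv _) measurableT [set 1]).
Qed.

(** A sandwich: the kernel has mass at most 1, so the integral is at most the marginal mass of the
    cube; on the points of full mass the integrand equals the marginal density. *)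
Lemma mu_star_eq1 : mu setT = 1 ->
  mu ((cube n `&` [set x | full x]) `*` [set: R]) = 1 ->
  mu_star Kstar c (cube n `*` `[0%R, 1%R]%classic) = 1.
Proof.
move=> muT muA; have [c0 mc muE] := hc; have mA := measurable_full.
have xs (x : n.-tuple R) : cube n x ->
    xsection (cube n `*` `[0%R, 1%R]%classic) x = `[0%R, 1%R]%classic.
  by move=> cx; rewrite in_xsectionX//; exact: mem_set.
have K1 (x : n.-tuple R) : Kstar x `[0%R, 1%R]%classic <= 1.
  apply: le_trans (sprob_kernel_le1 Kstar x).
  by apply: le_measure; rewrite ?inE.
have pt0 (x : n.-tuple R) : 0 <= (\1_(@cube R n) x)%:E *
    Kstar x (xsection (cube n `*` `[0%R, 1%R]%classic) x) * (c x)%:E.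
  rewrite indicE; case: (boolP (x \in cube n)) => [/set_mem cx|_].
    by rewrite xs// !mule_ge0// lee_fin.
  by rewrite !mul0e.
apply/eqP; rewrite eq_le; apply/andP; split.
- apply: (@le_trans _ _ (lebint (fun x => (\1_(@cube R n) x * c x)%:E))).
    apply: le_lebint => // x; rewrite EFinM indicE.
    case: (boolP (x \in cube n)) => [/set_mem cx|_]; last by rewrite !mul0e.
    by rewrite xs// mul1e lee_wpmul2r ?lee_fin.
  rewrite -muE; last exact: measurable_cube.
  rewrite -muT; apply: le_measure; rewrite ?inE//.
  by apply: measurableX => //; exact: measurable_cube.
- rewrite -muA muE//; apply: le_lebint => x.
    by rewrite lee_fin mulr_ge0.
  rewrite EFinM indicE; case: (boolP (x \in _)) => [/set_mem[cx fx]|_].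
    by rewrite indicE mem_set// xs// fx !mul1e.
  by rewrite mul0e.
Qed.

End mu_star.

(** Absorbs all null sets, leaving a comparison of single measures: at a point where K(x, .) is the
    normalized radial kernel, the chosen part must agree with K(x, .) on [0, 1]. *)
Lemma mu_star_joint (R : realType) (n : nat) (n0 : (0 < n)%N)
  (psi : R -> R) (hpsi : archimedean_generator psi)
  (mu : {measure set (n.-tuple R * R) -> \bar R})
  (hmu : copula_measure_of psi mu)
  (gamma : {measure set R -> \bar R}) (hgamma : williamson_measure psi n.+1 gamma)
  (c : n.-tuple R -> R) (hc : marginal_density mu c)
  (K : R.-pker (n.-tuple R) ~> R) (hK : markov_kernel_of mu K)
  (Kstar : R.-spker (n.-tuple R) ~> R) :
  (forall x s (k := radial_kernel hpsi n gamma s), 0 < s ->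
    k setT != 0%E -> (k setT < +oo)%E ->
    (forall B, measurable B -> k B = (K x B * k setT)%E) ->
    Kstar x `[0, 1]%classic = K x `[0, 1]%classic) ->
  mu_star Kstar c (cube n `*` `[0, 1]%classic) = 1%E.
Proof.
have [gsf gE] : exists gsf : {sigma_finite_measure set R -> \bar R},
    gamma = gsf :> {measure set R -> \bar R}.
  have gT : gamma setT = 1%E by case: hgamma.
  have gsf : sigma_finite setT gamma.
    exists (fun=> setT); first by rewrite bigcup_const.
    by move=> _; split => //; rewrite gT ltry.
  have [g gg] := sigma_finite_measureW gsf.
  by exists g; apply: eq_measure; exact: esym gg.
rewrite {}gE {gamma} in hgamma *.
have [rho rhoE] := lebesgue_tuple_measure R n.
move=> hstar.
have muT : mu setT = 1%E by case: hmu.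
apply: (mu_star_eq1 hc) => //.
have mA := measurable_full Kstar.
apply: (etrans (copula_measure_prod hpsi n0 hgamma rhoE hmu mA measurableT)).
pose A := cube n `&` [set x | Kstar x `[0, 1]%classic = 1%E].
have mi : measurable_fun setT (\1_A : n.-tuple R -> R) by exact: measurable_indic.
have mgA : measurable_fun setT (fun z : n.-tuple R =>
    (\1_A (gen_map psi z))%:E : \bar R).
  apply/measurable_EFinP.
  exact: (measurableT_comp mi (measurable_gen_map hpsi (n := n))).
have mO : measurable_fun setT (fun z : n.-tuple R => (\1_(@orthant R n) z)%:E : \bar R).
  by apply/measurable_EFinP; apply: measurable_indic; exact: measurable_orthant.
have mk := measurable_kappa hpsi gsf (B := [set: R]) measurableT.
have muTT := muT; rewrite -setXTT in muTT.
apply: (etrans _ muTT).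
apply: (etrans _ (esym
  (copula_measure_prod hpsi n0 hgamma rhoE hmu measurableT measurableT))).
apply: ge0_ae_eq_integral => //.
- apply: emeasurable_funM; last exact: mk.
  apply: emeasurable_funM; last exact: mO.
  exact: mgA.
- apply: emeasurable_funM; last exact: mk.
  apply: emeasurable_funM; last exact: mO.
  rewrite (_ : (fun _ => _) = cst 1%E); first exact: measurable_cst.
  by apply/funext => z; rewrite indicT.
apply: filterS (kernel_identification hpsi n0 hgamma rhoE hmu hK) => z hz _.
rewrite indicT mul1e [X in (_ * X%:E * _)%E]indicE [X in _ = (X%:E * _)%E]indicE.
case: (boolP (z \in @orthant R n)) => [/set_mem zO|_]; last by rewrite !mule0 !mul0e.
have [->|k0] := eqVneq (radial_kernel hpsi n gsf (tsum z) setT) 0%E.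
  by rewrite !mule0.
have [s0 kK] := hz zO k0.
rewrite indicE mem_set ?mul1e//; split => /=.
  by move=> i; rewrite tnth_map; exact: genext_itv.
have kfin := radial_kernel_fin hpsi hgamma s0.
rewrite (hstar _ _ s0 k0 kfin kK).
(* The radial kernel lives on [0, 1], and proportionality passes this to K. *)
have KC : K (gen_map psi z) (~` `[0, 1]%classic) = 0%E.
  have mC : measurable (~` `[0%R, 1%R]%classic : set R) by exact: measurableC.
  have : radial_kernel hpsi n gsf (tsum z) (~` `[0, 1]%classic) = 0%E.
    rewrite (radial_kernelE hpsi) (_ : _ @^-1` _ = set0) ?integral_set0//.
    apply/seteqP; split => // t; apply; rewrite /= in_itv/=.
    exact: last_coord_itv.
  by rewrite kK// => /eqP; rewrite mule_eq0 (negbTE k0) orbF => /eqP.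
by rewrite null_setC_eq//; exact: prob_kernel.
Qed.

Unset Implicit Arguments. Set Strict Implicit. Set Printing Implicit Defensive.

Theorem theorem5p10 (R : realType) (d : nat) (hd : (3 <= d)%N)
  (psi : R -> R) (hpsi : archimedean_generator psi)
  (mu : {measure set ((d.-1).-tuple R * R) -> \bar R})
  (hmu : copula_measure_of psi mu)
  (gamma : {measure set R -> \bar R}) (hgamma : williamson_measure psi d gamma)
  (c : (d.-1).-tuple R -> R) (hc : marginal_density mu c)
  (K : R.-pker ((d.-1).-tuple R) ~> R) (hK : markov_kernel_of mu K)
  (Kdis Ksing Kabs : R.-spker ((d.-1).-tuple R) ~> R)
  (hdecomp : forall x B, measurable B ->
     K x B = (Kdis x B + Ksing x B + Kabs x B)%E)
  (hdis : forall x, discrete_measure (Kdis x))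
  (hsing : forall x, singular_no_atoms (Ksing x))
  (habs : forall x, abs_continuous (Kabs x)) :
  [/\ abs_continuous gamma ->
        mu_star Kabs c (cube (d.-1) `*` `[0, 1]%classic) = 1%E,
      discrete_measure gamma ->
        mu_star Kdis c (cube (d.-1) `*` `[0, 1]%classic) = 1%E &
      singular_no_atoms gamma ->
        mu_star Ksing c (cube (d.-1) `*` `[0, 1]%classic) = 1%E].
Proof.
case: d => [//|n] in hd mu hmu hgamma c hc K hK Kdis Ksing Kabs hdecomp hdis hsing habs *.
have n0 : (0 < n)%N by rewrite -ltnS; apply: leq_trans hd.
have mI : measurable (`[0%R, 1%R]%classic : set R) by [].
(* Proportionality with a nonzero factor carries null sets of the radial kernel over to K(x, .), and
   with them each of the three types. *)
have null x s B (k := radial_kernel hpsi n gamma s) : measurable B ->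
    k setT != 0%E -> (forall B, measurable B -> k B = (K x B * k setT)%E) ->
    k B = 0%E -> K x B = 0%E.
  move=> mB k0 kK; rewrite kK// => /eqP.
  by rewrite mule_eq0 (negbTE k0) orbF => /eqP.
pose H := @mu_star_joint R n n0 psi hpsi mu hmu gamma hgamma c hc K hK.
split => hg; [apply: (H Kabs)|apply: (H Kdis)|apply: (H Ksing)]
  => x s k s0 k0 kfin kK.
- apply: (decomposition_ac (hdecomp x) (hdis x) (hsing x)) => // N mN N0.
  apply: (null x s N mN k0 kK); exact: (radial_kernel_ac hpsi n0 hgamma s0 hg).
- apply: (decomposition_discrete (hdecomp x) (hsing x) (habs x)) => //.
  have [S [cS S0]] := radial_kernel_discrete hpsi n s hg.
  exists S; split => //; apply: (null x s _ _ k0 kK S0).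
  exact/measurableC/countable_measurable.
- apply: (decomposition_singular (hdecomp x) (hdis x) (habs x)) => //.
  have [at0 [N [mN N0 NC]]] := radial_kernel_sing hpsi n0 hgamma s0 hg.
  split => [t|]; first exact: (null x s _ _ k0 kK (at0 t)).
  exists N; split => //; apply: (null x s _ _ k0 kK NC); exact: measurableC.
Qed.
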